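(* Let $\Gamma$ be a finitely generated group and let $G$ be a Cayley graph of $\Gamma$ (with respect to a finite generating set closed under inverses) that is simple, bipartite and non-amenable. Let $\mu$ be the product measure on $[0,1]^\Gamma$ with each coordinate having Lebesgue measure. Then there is an $\mathrm{Aut}(G)$-factor $\phi:[0,1]^\Gamma\to\{0,1\}^{E(G)}$ such that, for $\mu$-a.e. $\omega$, $\phi(\omega)$ (viewed as a set of edges of $G$) is a perfect matching of $G$.
   Context: For a group $\Gamma$ with finite symmetric generating set $S$, the Cayley graph $G$ has vertex set $\Gamma$, the neighbors of $x$ being the elements $sx$, $s\in S$ (so that $\Gamma$ acts on $G$ by automorphisms via right translations); $E(G)$ denotes its edge set and $\mathrm{Aut}(G)$ the full group of graph automorphisms of $G$. $\mathrm{Aut}(G)$ acts on $[0,1]^\Gamma$ by $(g\omega)(x):=\omega(g^{-1}x)$ and on $\{0,1\}^{E(G)}$ by $(g\xi)(e):=\xi(g^{-1}e)$. An $\mathrm{Aut}(G)$-factor is a measurable map $\phi:[0,1]^\Gamma\to\{0,1\}^{E(G)}$ that commutes with these actions: $\phi(g\omega)=g\,\phi(\omega)$ for all $g\in\mathrm{Aut}(G)$ and all $\omega$. An element of $\{0,1\}^{E(G)}$ is identified with the set of edges where it equals $1$. A perfect matching of a graph is a set of its edges such that each vertex belongs to exactly one edge of the set. A graph $G=(V,E)$ is non-amenable if $\inf\{|\partial_E K|/|K| : \emptyset\neq K\subset V \text{ finite}\}>0$, where $\partial_E K$ is the set of edges joining $K$ to its complement. *)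

(* Defs.v *)
From HB Require Import structures.
From mathcomp Require Import all_boot all_order all_algebra.
From mathcomp Require Import finmap.
From mathcomp Require Import all_classical all_reals all_analysis.

Set Implicit Arguments.
Unset Strict Implicit.
Unset Printing Implicit Defensive.

Import Order.TTheory GRing.Theory Num.Theory.

Local Open Scope classical_set_scope.
Local Open Scope ring_scope.

(* A graph on V is given by its adjacency relation, hence has no multiple
   edges; an edge is the (unordered) set of its endpoints. *)
Section graphs.
Context {V : choiceType}.
Implicit Type G : V -> V -> Prop.

Definition simple_graph G :=
  (forall x y, G x y -> G y x) /\ (forall x, ~ G x x).

Definition bipartite G :=
  exists c : V -> bool, forall x y, G x y -> c x != c y.

Definition edges G : set (set V) :=
  [set a | exists x y, G x y /\ a = [set x; y]].

Definition edge G : Type := set_type (edges G).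

Definition edge_boundary G (K : set V) : set (edge G) :=
  [set a | exists x y, [/\ K x, ~ K y & val a = [set x; y]]].

(* [fset_set] is the expected finite set only when the boundary of K is finite,
   which holds for all finite K as soon as G is locally finite. *)
Definition nonamenable (R : realType) G : Prop :=
  0 < inf [set r : R | exists2 K : {fset V}, K != fset0 &
    r = #|` fset_set (@edge_boundary G [set` K])|%:R / #|` K|%:R].

Definition perfect_matching G (M : set (edge G)) :=
  forall x : V, exists! a : edge G, M a /\ val a x.

Record graph_aut G := GraphAut {
  aut_fun :> V -> V;
  aut_inv : V -> V;
  aut_funK : cancel aut_fun aut_inv;
  aut_invK : cancel aut_inv aut_fun;
  aut_adj : forall x y, G (aut_fun x) (aut_fun y) <-> G x y }.

Lemma graph_autV_adj G (g : graph_aut G) x y :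
  G (aut_inv g x) (aut_inv g y) <-> G x y.
Proof. by rewrite -(aut_adj g) !aut_invK. Qed.

Definition graph_autV G (g : graph_aut G) : graph_aut G :=
  GraphAut (aut_invK g) (aut_funK g) (graph_autV_adj g).

Lemma edge_image_subproof G (g : graph_aut G) (a : edge G) :
  g @` val a \in edges G.
Proof.
case: a => a /= /[!inE] -[x [y [Gxy ->]]].
by exists (g x), (g y); rewrite image_setU !image_set1 aut_adj.
Qed.

Definition edge_image G (g : graph_aut G) (a : edge G) : edge G :=
  exist _ (g @` val a) (edge_image_subproof g a).

Definition act_vertex G (g : graph_aut G) X (omega : V -> X) : V -> X :=
  fun x => omega (graph_autV g x).

Definition act_edge G (g : graph_aut G) X (xi : edge G -> X) : edge G -> X :=
  fun a => xi (edge_image (graph_autV g) a).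

End graphs.

Section cayley.
Context {Gamma : groupType}.
Implicit Type S : {fset Gamma}.

Definition generates S :=
  forall H : {pred Gamma}, group_closed H -> {subset S <= H} ->
  forall x, x \in H.

Definition cayley S (x y : Gamma) : Prop := exists2 s, s \in S & y = (s * x)%g.

End cayley.

Definition coordinate_sets I d (X : measurableType d) : set (set (I -> X)) :=
  \bigcup_(i in [set: I]) preimage_set_system setT (fun f => f i) measurable.

(* I -> X with the product sigma-algebra. *)
Definition product_space I d (X : measurableType d) :=
  g_sigma_algebraType (@coordinate_sets I d X).

HB.instance Definition _ I d (X : measurableType d) :=
  Measurable.on (product_space I X).

(* The interval [0, 1], with the trace of the Borel sigma-algebra. *)
Section unit_interval.
Variable R : realType.

Definition unit_interval : Type := set_type `[0 : R, 1].

Lemma unit_interval0_subproof : (0 : R) \in `[0 : R, 1]%classic.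
Proof. by rewrite inE /= in_itv /= lexx ler01. Qed.

Definition unit_interval_val (x : unit_interval) : measurableTypeR R := val x.

HB.instance Definition _ := Choice.on unit_interval.
HB.instance Definition _ :=
  isPointed.Build unit_interval (exist _ 0 unit_interval0_subproof).
HB.instance Definition _ :=
  Measurable.copy unit_interval (g_sigma_algebra_preimageType unit_interval_val).

Definition uniform_law (A : set unit_interval) : \bar R :=
  lebesgue_measure (unit_interval_val @` A).

(* mu is the product over I of the Lebesgue measure on [0, 1]: it is determined
   by its values on the measurable rectangles with finite base. *)
Definition is_lebesgue_product (I : choiceType)
    (mu : probability (product_space I unit_interval) R) :=
  forall (F : {fset I}) (A : I -> set unit_interval),
    (forall i, measurable (A i)) ->
    mu [set omega | forall i, i \in F -> A i (omega i)] =
    (\prod_(i <- F) fine (uniform_law (A i)))%:E.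

End unit_interval.

Definition is_factor (R : realType) (V : choiceType) (G : V -> V -> Prop)
    (phi : product_space V (unit_interval R) -> product_space (edge G) bool) :=
  measurable_fun setT phi /\
  (forall (g : graph_aut G) omega,
    phi (act_vertex g omega) = act_edge g (phi omega)).

(* Main.v *)
(* Following Lyons and Nazarov, start from the empty matching and flip short
   augmenting paths equivariantly, lengthening the paths step by step.

   By Cheeger's inequality non-amenability gives a spectral gap on l^2(Gamma).
   A random variable on [0,1]^Gamma of mean zero splits orthogonally into parts
   depending on the labels of a nonempty finite set E of vertices; Gamma
   permutes these parts as it permutes the sets E, with finite stabilizers, so
   the gap passes to the Bernoulli shift. Hence if p and p' are the
   probabilities that 1 lies in an equivariant random set, respectively in its
   neighbourhood, the odds of p are at most a constant r < 1 times those of p'.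

   If a matching has no augmenting path of length at most 4n + 1, the sets of
   vertices reached from an unmatched vertex by alternating walks with 2k and
   2k + 1 edges are disjoint for k <= n (in a bipartite graph an augmenting walk
   contains an augmenting path). They grow by the expansion above, so a vertex
   is unmatched with probability at most r^n. Flipping the paths with at most N
   unmatched edges changes a vertex with probability at most 2N times the
   probability that it was unmatched; these bounds are summable, so by
   Borel-Cantelli the successive matchings converge almost surely, and the limit
   leaves no vertex unmatched. *)
Require Import Defs.
From HB Require Import structures.
From mathcomp Require Import all_boot all_order all_algebra.
From mathcomp Require Import finmap.
From mathcomp Require Import all_classical all_reals all_analysis.
From mathcomp Require Import measurable_realfun zify ring lra.

Set Implicit Arguments.
Unset Strict Implicit.
Unset Printing Implicit Defensive.

Import Order.TTheory GRing.Theory Num.Theory.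

Local Open Scope classical_set_scope.
Local Open Scope ring_scope.

(** * Spectral gap on the group *)

(** Equivariance is required for every [omega] and under all of Aut(G), while the estimates use
    right translations only. Hence no step may make an arbitrary choice: conflicts between paths and
    failure of convergence are met by default values, and only the conclusion that nobody stays
    unmatched is almost sure. Labels are almost surely distinct, so a short augmenting path is alone
    in its colour among the paths meeting it once the cells are fine enough; a schedule visiting
    each colour infinitely often then reaches all of them. The gap is proved for nonnegative
    functions on [Gamma]. This suffices, since it is applied to the norms of the orthogonal parts of
    a random variable, the correlations of the parts being bounded by Cauchy-Schwarz. The expansion
    compares the outer set with the complement of the inner set, which no edge joins; with
    [C = |S| - kappa^2 / (8 |S|)] the odds shrink by [C / (2 |S| - C)]. Disjointness gives odds at
    most 1 at the last index [n], and the recursion runs from there down to 0. *)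

Lemma seq_min_exists (R : realType) (T : eqType) (u : T -> R) (s : seq T) :
  s != [::] -> exists2 x, x \in s & forall y, y \in s -> u x <= u y.
Proof.
elim: s => [//|a [_ _|b s IH _]].
  by exists a; rewrite ?inE // => y; rewrite inE => /eqP ->.
have [x xs xmin] := IH isT.
have [le_ax|lt_xa] := leP (u a) (u x).
  exists a; first by rewrite inE eqxx.
  move=> y; rewrite inE => /orP[/eqP -> //|/xmin]; exact: le_trans.
exists x; first by rewrite inE xs orbT.
by move=> y; rewrite inE => /orP[/eqP ->|/xmin //]; exact: ltW.
Qed.

Section cheeger.
Variables (R : realType) (Gamma : groupType) (S : {fset Gamma}) (kappa : R).
Hypothesis kappa_gt0 : 0 < kappa.
Hypothesis expanding : forall K : {fset Gamma},
  kappa * #|` K|%:R <= \sum_(x <- K) \sum_(s <- S) ((s * x)%g \notin K)%:R.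

(** Layers are peeled off one at a time: subtracting the minimum [u x0] of [u] over [K] kills [u] at
    [x0], so the induction passes to [K] without [x0]. The removed layer is a multiple of the
    indicator of [K], for which the claim is [expanding K]. *)
Lemma coarea (u : Gamma -> R) (K : {fset Gamma}) :
  (forall x, x \notin K -> u x = 0) ->
  (forall x, 0 <= u x) ->
  kappa * \sum_(x <- K) u x <=
  \sum_(x <- K) \sum_(s <- S) Num.max 0 (u x - u (s * x)%g).
Proof.
have [n] := ubnP #|` K|; elim: n u K => // n IH u K leK supp u_ge0.
have [->|K0] := eqVneq K fset0; first by rewrite !big_seq_fset0 mulr0.
have [|x0 x0K x0min] := @seq_min_exists R Gamma u K.
  by apply: contraNneq K0 => K0; rewrite -cardfs_eq0 cardfE cardE; rewrite
    -(size_map val) /= -enum_fsetE K0.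
pose u' x := if x \in K then u x - u x0 else 0.
have u'_ge0 x : 0 <= u' x.
  by rewrite /u'; case: ifP => // xK; rewrite subr_ge0 x0min.
have u'x0 : u' x0 = 0 by rewrite /u' x0K subrr.
have := IH u' (K `\ x0)%fset.
rewrite -ltnS (leq_trans _ leK); last first.
  by rewrite ltnS [X in (_ < X)%N](cardfsD1 x0) x0K.
move=> /(_ isT); have supp' x : x \notin (K `\ x0)%fset -> u' x = 0.
  by rewrite !inE negb_and negbK => /orP[/eqP -> //|/negPf]; rewrite /u' => ->.
move=> /(_ supp' u'_ge0).
have -> : \sum_(x <- (K `\ x0)%fset) u' x = \sum_(x <- K) u' x.
  by rewrite [RHS](big_fsetD1 x0) //= u'x0 add0r.
have -> : \sum_(x <- (K `\ x0)%fset) \sum_(s <- S)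
     Num.max 0 (u' x - u' (s * x)%g) =
   \sum_(x <- K) \sum_(s <- S) Num.max 0 (u' x - u' (s * x)%g).
  rewrite [RHS](big_fsetD1 x0) //= [X in _ = X + _]big1 ?add0r // => s _.
  by rewrite u'x0 sub0r; apply/max_idPl; rewrite oppr_le0.
have -> : \sum_(x <- K) u' x = \sum_(x <- K) u x - u x0 * #|` K|%:R.
  rewrite mulr_natr -sum1_size -sumrMnr -sumrB big_seq [RHS]big_seq.
  by apply: eq_bigr => x xK; rewrite /u' xK.
have -> : \sum_(x <- K) \sum_(s <- S) Num.max 0 (u x - u (s * x)%g) =
   \sum_(x <- K) \sum_(s <- S) Num.max 0 (u' x - u' (s * x)%g) +
   u x0 * \sum_(x <- K) \sum_(s <- S) ((s * x)%g \notin K)%:R.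
  rewrite mulr_sumr -big_split /= big_seq [RHS]big_seq.
  apply: eq_bigr => x xK; rewrite mulr_sumr -big_split /=.
  apply: eq_bigr => s _; rewrite /u' xK; case: ifPn => sxK /=.
    by rewrite mulr0 addr0 opprB addrA subrK.
  rewrite (supp _ sxK) !subr0 mulr1.
  rewrite !max_r ?subrK ?subr_ge0 //; exact: x0min.
have := ler_wpM2l (u_ge0 x0) (expanding K).
rewrite mulrBr => h1 h2.
by have := lerD h2 h1; rewrite [kappa * (_ * _)]mulrCA subrK.
Qed.

(* With [u = h ^ 2], [|a^2 - b^2| <= l/2 (a-b)^2 + 1/(2l) (a+b)^2] for
   [l = 4 |S| / kappa] turns the co-area inequality into a spectral gap. *)
Lemma cheeger (h : Gamma -> R) (Y : {fset Gamma}) :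
  (forall x, x \notin Y -> h x = 0) -> (forall x, 0 <= h x) ->
  (0 < #|` S|)%N ->
  \sum_(x <- Y) \sum_(s <- S) h x * h (s * x)%g <=
  (#|` S|%:R - kappa ^+ 2 / (8 * #|` S|%:R)) * \sum_(x <- Y) h x ^+ 2.
Proof.
move=> supp h_ge0 S_gt0; set d : R := #|` S|%:R.
have d_gt0 : 0 < d by rewrite ltr0n.
set N := \sum_(x <- Y) h x ^+ 2; set C := (X in X <= _).
have N_ge0 : 0 <= N by apply: sumr_ge0 => x _; exact: sqr_ge0.
have shiftN s : \sum_(x <- Y) h (s * x)%g ^+ 2 <= N.
  have -> : \sum_(x <- Y) h (s * x)%g ^+ 2 =
      \sum_(x <- [fset (s * x)%g | x in Y]%fset) h x ^+ 2.
    rewrite [RHS]big_imfset //= => x y _ _; exact: mulgI.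
  set Y' := [fset _ | _ in _]%fset.
  rewrite (bigID (mem Y)) /= [X in _ + X]big1 ?addr0; last first.
    by move=> x /supp ->; rewrite expr0n.
  rewrite big_fset_condE /= [leRHS](bigID (mem Y')) /=.
  rewrite [X in _ <= X + _]big_fset_condE /=.
  have -> : [fset x in Y | x \in Y']%fset = [fset x in Y' | x \in Y]%fset.
    by apply/fsetP => x; rewrite !inE andbC.
  by rewrite lerDl sumr_ge0 // => x _; exact: sqr_ge0.
have sumconst (f : Gamma -> R) :
    \sum_(x <- Y) \sum_(s <- S) f x = d * \sum_(x <- Y) f x.
  rewrite mulr_sumr; apply: eq_bigr => x _.
  by rewrite big_const_seq count_predT iter_addr_0 -mulr_natl.
pose l := 4 * d / kappa.
have l_gt0 : 0 < l by rewrite divr_gt0 // mulr_gt0.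
have l2 : 0 <= (2 * l)^-1 by rewrite invr_ge0 mulr_ge0 // ltW.
have l'2 : 0 <= l / 2 by rewrite divr_ge0 // ltW.
have supp2 x : x \notin Y -> h x ^+ 2 = 0 by move=> /supp ->; rewrite expr0n.
have co := coarea supp2 (fun x => sqr_ge0 (h x)); rewrite -/N in co.
have amgm : \sum_(x <- Y) \sum_(s <- S) Num.max 0 (h x ^+ 2 - h (s * x)%g ^+ 2)
   <= (l / 2 + (2 * l)^-1) * (d * N + \sum_(s <- S) \sum_(x <- Y) h (s * x)%g ^+ 2)
     + ((2 * l)^-1 - l / 2) * 2 * C.
  rewrite -sumconst [leLHS]exchange_big /= /C.
  rewrite [X in _ * (X + _) + _]exchange_big /= [X in _ + _ * X]exchange_big /=.
  rewrite -big_split /= !mulr_sumr -big_split /=; apply: ler_sum => s _.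
  rewrite -big_split /= !mulr_sumr -big_split /=; apply: ler_sum => x _.
  set a := h x; set b := h (s * x)%g.
  have -> : (l / 2 + (2 * l)^-1) * (a ^+ 2 + b ^+ 2) +
      ((2 * l)^-1 - l / 2) * 2 * (a * b) =
      (l / 2) * (a - b) ^+ 2 + (2 * l)^-1 * (a + b) ^+ 2.
    by field; rewrite gt_eqF.
  rewrite ge_max; apply/andP; split.
    by rewrite addr_ge0 // mulr_ge0 // sqr_ge0.
  rewrite -subr_ge0.
  have -> : l / 2 * (a - b) ^+ 2 + (2 * l)^-1 * (a + b) ^+ 2 -
      (a ^+ 2 - b ^+ 2) = (2 * l)^-1 * ((a + b) - l * (a - b)) ^+ 2.
    by field; rewrite gt_eqF.
  by rewrite mulr_ge0 // sqr_ge0.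
have shift : \sum_(s <- S) \sum_(x <- Y) h (s * x)%g ^+ 2 <= d * N.
  apply: (@le_trans _ _ (\sum_(s <- S) N)); first exact: ler_sum.
  by rewrite big_const_seq count_predT iter_addr_0 -mulr_natl.
(* This crude bound serves to replace [(d * N + C) / l] by [2 * d * N / l], the error term in
   [h3]. *)
have C_le : C <= d * N.
  apply: (@le_trans _ _ ((d * N + \sum_(s <- S) \sum_(x <- Y) h (s * x)%g ^+ 2) / 2));
    last by lra.
  rewrite -sumconst /C [leLHS]exchange_big /= [X in (X + _) / _]exchange_big /=.
  rewrite -big_split /= mulr_suml; apply: ler_sum => s _.
  rewrite -big_split /= mulr_suml; apply: ler_sum => x _.
  rewrite -subr_ge0; set a := h x; set b := h _.
  have -> : (a ^+ 2 + b ^+ 2) / 2 - a * b = (a - b) ^+ 2 / 2 by field.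
  by rewrite divr_ge0 ?sqr_ge0.
have h1 := le_trans co amgm.
have h2 : kappa * N <= (l / 2 + (2 * l)^-1) * (d * N + d * N) +
    ((2 * l)^-1 - l / 2) * 2 * C.
  apply: (le_trans h1); rewrite lerD2r ler_wpM2l ?lerD2l //.
  exact: addr_ge0.
have h3 : kappa * N <= l * (d * N - C) + 2 * (l^-1 * (d * N)).
  apply: (le_trans h2); rewrite -subr_ge0.
  have -> : l * (d * N - C) + 2 * (l^-1 * (d * N)) -
      ((l / 2 + (2 * l)^-1) * (d * N + d * N) + ((2 * l)^-1 - l / 2) * 2 * C) =
      l^-1 * (d * N - C) by field; rewrite gt_eqF.
  by rewrite mulr_ge0 ?invr_ge0 ?(ltW l_gt0) // subr_ge0.
(* The choice of [l] makes the error term exactly half of the left-hand side, which absorbs it. *)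
have h4 : kappa * N / 2 <= l * (d * N - C).
  have e : 2 * (l^-1 * (d * N)) = kappa * N / 2.
    by rewrite /l; field; rewrite !gt_eqF.
  by move: h3; rewrite e; lra.
rewrite -subr_ge0.
have -> : (d - kappa ^+ 2 / (8 * d)) * N - C =
    l^-1 * (l * (d * N - C) - kappa * N / 2).
  by rewrite /l; field; rewrite !gt_eqF.
by rewrite mulr_ge0 ?invr_ge0 ?(ltW l_gt0) // subr_ge0.
Qed.

End cheeger.

(** Every boundary edge is [{x, s x}] with [x] in [K], [s] in [S] and [s x] outside [K]; symmetry of
    [S] enters when the edge is presented from its outer end. The pair [(x, s)] determines the edge,
    so choosing one pair per edge is injective and there are at least as many pairs as edges. *)
Lemma nonamenable_expanding (R : realType) (Gamma : groupType)
    (S : {fset Gamma}) :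
  {in S, forall s, s^-1%g \in S} ->
  nonamenable R (cayley S) -> exists2 kappa : R, 0 < kappa &
  forall K : {fset Gamma},
    kappa * #|` K|%:R <= \sum_(x <- K) \sum_(s <- S) ((s * x)%g \notin K)%:R.
Proof.
move=> S_sym; rewrite /nonamenable; set A := (X in inf X) => inf_gt0.
exists (inf A) => // K; have [->|K0] := eqVneq K fset0.
  by rewrite big_seq_fset0 cardfs0 mulr0.
have K_gt0 : 0 < #|` K|%:R :> R by rewrite ltr0n cardfs_gt0.
set B := @edge_boundary _ (cayley S) [set` K].
have infK : inf A <= #|` fset_set B|%:R / #|` K|%:R.
  apply: ge_inf; last by exists K.
  by exists 0 => _ [K' _ ->]; rewrite divr_ge0 ?ler0n.
rewrite -ler_pdivlMr // (le_trans infK) // ler_pM2r ?invr_gt0 //.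
pose P (p : Gamma * Gamma) := (p.2 * p.1)%g \notin K.
have -> : \sum_(x <- K) \sum_(s <- S) ((s * x)%g \notin K)%:R =
    (size [seq p <- [seq (x, s) | x <- K, s <- S] | P p])%:R :> R.
  rewrite size_filter -sum1_count [X in _ = X%:R]big_mkcond big_allpairs_dep natr_sum.
  apply: eq_bigr => x _; rewrite natr_sum /P /=.
  by apply: eq_bigr => s _; case: ifP.
rewrite ler_nat.
(* On an infinite set [fset_set] takes the value [fset0], and the bound is trivial. *)
have [finB|infB] := pselect (finite_set B); last first.
  by rewrite (_ : fset_set B = fset0) // /fset_set; case: pselect.
pose Q (a : edge (cayley S)) (p : Gamma * Gamma) :=
  [/\ p.1 \in K, p.2 \in S, P p & val a = [set p.1; (p.2 * p.1)%g]].
pose h a := xget (1%g, 1%g) (Q a).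
have Qh a : a \in fset_set B -> Q a (h a).
  rewrite in_fset_set // inE => -[x [y [xK yK a_xy]]].
  apply: xgetPex; have : val a \in edges (cayley S) by case: (a).
  rewrite inE => -[x' [y' [[s sS ->] axy']]].
  have : val a x by rewrite a_xy; left.
  have : val a y by rewrite a_xy; right.
  move: xK yK; rewrite axy' /= => xK yK y_eq x_eq; case: y_eq x_eq yK xK => -> [] -> yK xK.
  - by case: yK.
  - exists ((s * x')%g, s^-1%g).
    rewrite /Q /P /= mulKg; split => //; [exact: S_sym|exact/negP|].
    by rewrite axy' setUC.
  - by exists (x', s); split => //; exact/negP.
  - by case: yK.
rewrite -(size_map h); apply: uniq_leq_size.
  rewrite map_inj_in_uniq ?fset_uniq // => a b /Qh[_ _ _ ha] /Qh[_ _ _ hb] hab.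
  by apply/val_inj; rewrite ha hb hab.
move=> _ /mapP[a /Qh[h1 h2 h3 _] ->]; rewrite mem_filter h3 /=.
by apply/allpairsP; exists (h a); rewrite h1 h2; case: (h a).
Qed.

(** * Spectral gap on finite subsets *)

Section translates_of_finite_sets.
Variables (R : realType) (Gamma : groupType).
Implicit Types (D E : {fset Gamma}) (K : {fset {fset Gamma}}).

Definition rtrans E (x : Gamma) : {fset Gamma} := [fset (y * x)%g | y in E]%fset.

Lemma rtrans1 E : rtrans E 1%g = E.
Proof.
apply/fsetP => x; apply/imfsetP/idP => [[y /= yE ->]|xE]; first by rewrite mulg1.
by exists x; rewrite ?mulg1.
Qed.

Lemma rtransM E x y : rtrans (rtrans E x) y = rtrans E (x * y)%g.
Proof.
apply/fsetP => z; apply/imfsetP/imfsetP => [[_ /= /imfsetP[t /= tE ->] ->]|].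
  by exists t; rewrite ?mulgA.
move=> [t /= tE ->]; exists (t * x)%g; rewrite ?mulgA //=.
by apply/imfsetP; exists t.
Qed.

Lemma rtransK x : cancel (rtrans^~ x) (rtrans^~ x^-1%g).
Proof. by move=> E; rewrite rtransM mulgV rtrans1. Qed.

Lemma rtransVK x : cancel (rtrans^~ x^-1%g) (rtrans^~ x).
Proof. by move=> E; rewrite rtransM mulVg rtrans1. Qed.

Lemma mem_rtrans E x y : ((y * x)%g \in rtrans E x) = (y \in E).
Proof.
apply/imfsetP/idP => [[z /= zE /mulIg -> //]|yE]; by exists y.
Qed.

Lemma card_rtrans E x : #|` rtrans E x| = #|` E|.
Proof. by apply: card_imfset => y z; exact: mulIg. Qed.

(* A pair [(E, y)] with [y \in E] is encoded by [(D, y^-1)] where [E = D y] and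
   [1 \in D]; each [E] arises from [#|E|] pairs, hence the weight. This turns
   the action on finite sets, which has finite stabilizers, into a disjoint
   union of copies of the free action of [Gamma] on itself. *)
Lemma sum_pointed_sets (K : {fset {fset Gamma}}) : fset0 \notin K ->
  exists (Ds : {fset {fset Gamma}}) (Y : {fset Gamma}),
  forall b : {fset Gamma} -> R, (forall E, E \notin K -> b E = 0) ->
  (forall D x, D \in Ds -> x \notin Y -> b (rtrans D x^-1%g) = 0) /\
  \sum_(D <- Ds) \sum_(x <- Y) (#|` D|%:R)^-1 * b (rtrans D x^-1%g) =
  \sum_(E <- K) b E.
Proof.
move=> K0; pose U := (\bigcup_(E <- K) E)%fset.
pose Ds := [fset rtrans E y^-1%g | E in K, y in E]%fset.
have Ds1 D : D \in Ds -> 1%g \in D.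
  move=> /imfset2P[/= E EK [y /= yE ->]].
  by rewrite -(mulgV y) mem_rtrans.
have memU E y : E \in K -> y \in E -> y \in U.
  by move=> EK yE; apply/bigfcupP; exists E; rewrite // EK.
exists Ds, [fset y^-1%g | y in U]%fset => b supp; split.
  move=> D x /Ds1 D1 xU; apply: supp; apply: contra xU => DxK.
  apply/imfsetP; exists x^-1%g; rewrite ?invgK //=.
  by apply: (memU _ _ DxK); rewrite -[X in X \in _]mul1g mem_rtrans.
rewrite exchange_big /= big_imfset /=; last by move=> x y _ _; exact: invg_inj.
transitivity (\sum_(y <- U) \sum_(E <- K | y \in E) (#|` E|%:R)^-1 * b E).
  apply: eq_big_seq => y yU.
  under eq_bigr do rewrite invgK -(card_rtrans _ y).
  pose f E := (#|` E|%:R)^-1 * b E.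
  transitivity (\sum_(E <- [fset rtrans D y | D in Ds]%fset) f E).
    by rewrite big_imfset //= => D D' _ _; exact: (can_inj (rtransK y)).
  rewrite (bigID (mem K)) /= [X in _ + X]big1 ?addr0; last first.
    by move=> E /supp; rewrite /f => ->; rewrite mulr0.
  rewrite [LHS]big_fset_condE [RHS]big_fset_condE /=; congr (\sum_(E <- enum_fset _) f E).
  apply/fsetP => E; rewrite !inE /= [RHS]andbC.
  have [EK|] := boolP (E \in K); rewrite ?andbT ?andbF //.
  apply/imfsetP/idP => [[D /= /Ds1 D1 ->]|yE].
    by rewrite -[X in X \in _](mul1g y) mem_rtrans.
  exists (rtrans E y^-1%g); last by rewrite rtransVK.
  by apply/imfset2P; exists E => //; exists y.
rewrite (exchange_big_dep xpredT) //=; apply: eq_big_seq => E EK.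
rewrite big_fset_condE /= (_ : [fset y in U | y \in E]%fset = E); last first.
  apply/fsetP => y; rewrite !inE /=.
  by have [yE|] := boolP (y \in E); rewrite ?andbF // (memU E).
rewrite big_const_seq count_predT iter_addr_0 -[LHS]mulr_natl mulrA divff ?mul1r //.
by rewrite pnatr_eq0 cardfs_eq0; apply: contraNneq K0 => <-.
Qed.

(** For each [D] given by [sum_pointed_sets], the function sending [x] to [a (D x^-1)] lives on
    [Gamma], and replacing [x] by [s x] translates the set by [s^-1]. The hypothesis is applied to
    each of these functions and summed with weights [1 / |D|]. The empty set has to be excluded:
    every translation fixes it. *)
Lemma gap_on_finite_sets (S : {fset Gamma}) (C : R) :
  (forall (h : Gamma -> R) (Y : {fset Gamma}),
    (forall x, x \notin Y -> h x = 0) -> (forall x, 0 <= h x) ->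
    \sum_(x <- Y) \sum_(s <- S) h x * h (s * x)%g <=
    C * \sum_(x <- Y) h x ^+ 2) ->
  forall (a : {fset Gamma} -> R) (K : {fset {fset Gamma}}),
    fset0 \notin K -> (forall E, E \notin K -> a E = 0) ->
    (forall E, 0 <= a E) ->
  \sum_(E <- K) \sum_(s <- S) a E * a (rtrans E s^-1%g) <=
  C * \sum_(E <- K) a E ^+ 2.
Proof.
move=> gap a K K0 supp a_ge0.
have [Ds [Y DsY]] := sum_pointed_sets K0.
have [suppY _] := DsY a supp.
have [|_ <-] := DsY (fun E => \sum_(s <- S) a E * a (rtrans E s^-1%g)).
  by move=> E /supp ->; rewrite big1 // => s _; rewrite mul0r.
have [|_ <-] := DsY (fun E => a E ^+ 2).
  by move=> E /supp ->; rewrite expr0n.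
rewrite mulr_sumr big_seq [leRHS]big_seq; apply: ler_sum => D DDs.
rewrite -!mulr_sumr mulrCA ler_wpM2l ?invr_ge0 ?ler0n //.
have := gap (fun x => a (rtrans D x^-1%g)) Y (suppY D^~ DDs) (fun=> a_ge0 _).
congr (_ <= _); apply: eq_bigr => x _; apply: eq_bigr => s _.
by rewrite rtransM invgM.
Qed.

End translates_of_finite_sets.

(** * Bounded random variables *)

Section bounded_expectation.
Context d (T : measurableType d) (R : realType) (mu : probability T R).
Implicit Types (f g : T -> R) (A : set T).

(** Boundedness makes all products integrable, so the L^2 arguments need no L^2 space. *)
Definition bounded_measurable f :=
  measurable_fun setT f /\ exists M, forall x, `|f x| <= M.

Local Notation bm := bounded_measurable.

Lemma bm_cst c : bm (cst c).
Proof. by split; [exact: measurable_cst|exists `|c|]. Qed.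

Lemma bm_indic A : measurable A -> bm \1_A.
Proof.
move=> mA; split; first exact: measurable_indic.
by exists 1 => x; rewrite indicE; case: (_ \in _); rewrite ?normr1 ?normr0.
Qed.

Lemma bmD f g : bm f -> bm g -> bm (f \+ g).
Proof.
move=> [mf [M fM]] [mg [M' gM']]; split; first exact: measurable_funD.
exists (M + M') => x; exact: (le_trans (ler_normD _ _) (lerD (fM x) (gM' x))).
Qed.

Lemma bmM f g : bm f -> bm g -> bm (f \* g).
Proof.
move=> [mf [M fM]] [mg [M' gM']]; split; first exact: measurable_funM.
by exists (M * M') => x; rewrite normrM ler_pM.
Qed.

Lemma bmZ c f : bm f -> bm (fun x => c * f x).
Proof. exact: (bmM (bm_cst c)). Qed.

Lemma bmB f g : bm f -> bm g -> bm (f \- g).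
Proof.
move=> bf bg; have := bmD bf (bmZ (-1) bg); congr bm.
by apply/funext => x /=; rewrite mulN1r.
Qed.

Lemma bm_sqr f : bm f -> bm (fun x => f x ^+ 2).
Proof. by move=> bf; exact: bmM. Qed.

Lemma bm_sum (I : Type) (r : seq I) (P : pred I) (F : I -> T -> R) :
  (forall i, bm (F i)) -> bm (fun x => \sum_(i <- r | P i) F i x).
Proof.
move=> bF; elim: r => [|i r IH].
  rewrite (_ : (fun _ => _) = cst 0); first exact: bm_cst.
  by apply/funext => x; rewrite big_nil.
have [Pi|nPi] := boolP (P i).
  have := bmD (bF i) IH; congr bm.
  by apply/funext => x; rewrite big_cons Pi.
by move: IH; congr bm; apply/funext => x; rewrite big_cons (negPf nPi).
Qed.

Lemma eq_bm f g : f =1 g -> bm f -> bm g.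
Proof. by move=> /funext ->. Qed.

Lemma bm_prod (I : eqType) (r : seq I) (F : I -> T -> R) :
  (forall i, i \in r -> bm (F i)) -> bm (fun x => \prod_(i <- r) F i x).
Proof.
elim: r => [|i r IH] bF.
  by apply: eq_bm (bm_cst 1) => x; rewrite big_nil.
apply: eq_bm (bmM (bF i (mem_head _ _)) (IH _)) => [x|j jr].
  by rewrite big_cons.
by apply: bF; rewrite inE jr orbT.
Qed.

Lemma bm_integrable f : bm f -> mu.-integrable setT (EFin \o f).
Proof.
move=> [mf [M fM]]; apply: measurable_bounded_integrable.
- exact: measurableT.
- exact: (le_lt_trans (probability_le1 mu measurableT) (ltry 1)).
- exact: mf.
- by exists M; split; [exact: num_real|move=> N MN x _; exact: le_trans (fM x) (ltW MN)].
Qed.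

Definition Ex f : R := \int[mu]_x f x.

Lemma ExD f g : bm f -> bm g -> Ex (fun x => f x + g x) = Ex f + Ex g.
Proof. by move=> bf bg; rewrite /Ex RintegralD //; exact: bm_integrable. Qed.

Lemma ExB f g : bm f -> bm g -> Ex (fun x => f x - g x) = Ex f - Ex g.
Proof. by move=> bf bg; rewrite /Ex RintegralB //; exact: bm_integrable. Qed.

Lemma ExZ c f : bm f -> Ex (fun x => c * f x) = c * Ex f.
Proof. by move=> bf; rewrite /Ex RintegralZl //; exact: bm_integrable. Qed.

Lemma Ex_sum (I : Type) (r : seq I) (P : pred I) (F : I -> T -> R) :
  (forall i, bm (F i)) ->
  Ex (fun x => \sum_(i <- r | P i) F i x) = \sum_(i <- r | P i) Ex (F i).
Proof.
move=> bF; elim: r => [|i r IH].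
  rewrite big_nil /Ex (_ : (fun _ => _) = cst 0) ?Rintegral_cst ?mul0r //.
  by apply/funext => x; rewrite big_nil.
rewrite big_cons -IH; case: ifPn => Pi; last first.
  by congr Ex; apply/funext => x; rewrite big_cons (negPf Pi).
rewrite -ExD //; last exact: bm_sum.
by congr Ex; apply/funext => x; rewrite big_cons Pi.
Qed.

Lemma Ex_ge0 f : (forall x, 0 <= f x) -> 0 <= Ex f.
Proof. by move=> f0; exact: Rintegral_ge0. Qed.

Lemma le_Ex f g : bm f -> bm g -> (forall x, f x <= g x) -> Ex f <= Ex g.
Proof. by move=> bf bg fg; apply: le_Rintegral => //; exact: bm_integrable. Qed.

Lemma Ex_cst c : Ex (cst c) = c.
Proof.
rewrite /Ex Rintegral_cst // (_ : fine _ = 1) ?mulr1 //.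
exact: (congr1 fine (probability_setT mu)).
Qed.

Definition Pr A : R := fine (mu A).

Lemma Ex_indic A : measurable A -> Ex \1_A = Pr A.
Proof. by move=> mA; rewrite /Ex /Rintegral integral_indic // setIT. Qed.

Lemma EFin_Pr A : measurable A -> (Pr A)%:E = mu A.
Proof. by move=> mA; rewrite /Pr fineK // fin_num_measure. Qed.

Lemma Pr_ge0 A : 0 <= Pr A.
Proof. by rewrite /Pr fine_ge0 // measure_ge0. Qed.

Lemma Pr_le A B : measurable A -> measurable B -> A `<=` B -> Pr A <= Pr B.
Proof.
move=> mA mB AB; rewrite -lee_fin !EFin_Pr //.
by apply: le_measure => //; rewrite inE.
Qed.

Lemma PrC A : measurable A -> Pr (~` A) = 1 - Pr A.
Proof.
move=> mA; apply: EFin_inj; rewrite EFin_Pr ?probability_setC //.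
  by rewrite EFinB EFin_Pr.
exact: measurableC.
Qed.

Lemma Pr0 : Pr set0 = 0.
Proof. by rewrite /Pr measure0. Qed.

Definition nrm f := Num.sqrt (Ex (fun x => f x ^+ 2)).

Lemma nrm_ge0 f : 0 <= nrm f.
Proof. exact: sqrtr_ge0. Qed.

Lemma nrm_sqr f : nrm f ^+ 2 = Ex (fun x => f x ^+ 2).
Proof. by rewrite sqr_sqrtr // Ex_ge0 // => x; exact: sqr_ge0. Qed.

(** The mean of [(a f - b g)^2] is nonnegative, and [a = nrm g], [b = nrm f] gives the bound. If
    exactly one norm vanishes while the mean [c] of [f g] is positive, the other norm squared over
    [c], as weight of the null function, makes this quadratic form negative. *)
Lemma cauchy_schwarz f g : bm f -> bm g ->
  Ex (fun x => f x * g x) <= nrm f * nrm g.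
Proof.
move=> bf bg; have bfg := bmM bf bg.
have key a b : 0 <= a ^+ 2 * nrm f ^+ 2 - 2 * (a * b) * Ex (fun x => f x * g x)
    + b ^+ 2 * nrm g ^+ 2.
  rewrite !nrm_sqr -!ExZ //; try exact: bm_sqr.
  rewrite -ExB; [|exact/bmZ/bm_sqr|exact: bmZ].
  rewrite -ExD; [|by apply: bmB; [exact/bmZ/bm_sqr|exact: bmZ]|exact/bmZ/bm_sqr].
  apply: Ex_ge0 => x.
  have -> : a ^+ 2 * f x ^+ 2 - 2 * (a * b) * (f x * g x) + b ^+ 2 * g x ^+ 2 =
    (a * f x - b * g x) ^+ 2 by ring.
  exact: sqr_ge0.
have nf := nrm_ge0 f; have ng := nrm_ge0 g.
set c := Ex _ in key *; have [c0|c0] := leP c 0.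
  by rewrite (le_trans c0) // mulr_ge0.
have [f0|f0] := eqVneq (nrm f) 0.
  have [g0|g0] := eqVneq (nrm g) 0; first by have := key 1 1; rewrite f0 g0; lra.
  have := key (nrm g ^+ 2 / c) 1; rewrite f0.
  have -> : (nrm g ^+ 2 / c) ^+ 2 * 0 ^+ 2 - 2 * (nrm g ^+ 2 / c * 1) * c +
     1 ^+ 2 * nrm g ^+ 2 = - nrm g ^+ 2 by field; rewrite gt_eqF.
  have : 0 < nrm g ^+ 2 by rewrite exprn_even_gt0.
  lra.
have [g0|g0] := eqVneq (nrm g) 0.
  have := key 1 (nrm f ^+ 2 / c); rewrite g0.
  have -> : 1 ^+ 2 * nrm f ^+ 2 - 2 * (1 * (nrm f ^+ 2 / c)) * c +
     (nrm f ^+ 2 / c) ^+ 2 * 0 ^+ 2 = - nrm f ^+ 2 by field; rewrite gt_eqF.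
  have : 0 < nrm f ^+ 2 by rewrite exprn_even_gt0.
  lra.
have fg0 : 0 < nrm f * nrm g by rewrite mulr_gt0 // lt_def ?f0 ?g0.
have := key (nrm g) (nrm f).
have -> : nrm g ^+ 2 * nrm f ^+ 2 - 2 * (nrm g * nrm f) * c +
  nrm f ^+ 2 * nrm g ^+ 2 = 2 * ((nrm f * nrm g) * (nrm f * nrm g - c)) by ring.
by rewrite pmulr_rge0 // pmulr_rge0 // subr_ge0.
Qed.

Lemma eq_nrm f g : f =1 g -> nrm f = nrm g.
Proof. by move=> /funext ->. Qed.

Lemma nrmN f : nrm (fun x => - f x) = nrm f.
Proof. by rewrite /nrm; congr (Num.sqrt (Ex _)); apply/funext => x; rewrite sqrrN. Qed.

Lemma bmN f : bm f -> bm (fun x => - f x).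
Proof.
by move=> /(bmZ (-1)); congr bm; apply/funext => x; rewrite mulN1r.
Qed.

Lemma cauchy_schwarz_norm f g : bm f -> bm g ->
  `|Ex (fun x => f x * g x)| <= nrm f * nrm g.
Proof.
move=> bf bg; rewrite ler_norml cauchy_schwarz // andbT lerNl -mulN1r -ExZ.
  rewrite -nrmN; have := cauchy_schwarz (bmN bf) bg; congr (Ex _ <= _).
  by apply/funext => x; rewrite mulN1r mulNr.
exact: bmM.
Qed.

Lemma nrmD f g : bm f -> bm g -> nrm (fun x => f x + g x) <= nrm f + nrm g.
Proof.
move=> bf bg; rewrite -ler_sqr ?nnegrE ?addr_ge0 ?nrm_ge0 // sqrrD nrm_sqr.
have -> : Ex (fun x => (f x + g x) ^+ 2) =
    nrm f ^+ 2 + 2 * Ex (fun x => f x * g x) + nrm g ^+ 2.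
  rewrite !nrm_sqr -ExZ; last exact: bmM.
  rewrite -ExD; [|exact: bm_sqr|exact/bmZ/bmM].
  rewrite -ExD; [|by apply: bmD; [exact: bm_sqr|exact/bmZ/bmM]|exact: bm_sqr].
  by congr Ex; apply/funext => x /=; ring.
by have := cauchy_schwarz bf bg; lra.
Qed.

Lemma nrmZ c f : bm f -> nrm (fun x => c * f x) = `|c| * nrm f.
Proof.
move=> bf; rewrite /nrm -sqrtr_sqr -sqrtrM ?sqr_ge0 // -ExZ; last exact: bm_sqr.
by congr (Num.sqrt (Ex _)); apply/funext => x; rewrite exprMn.
Qed.

Lemma bm_comp (tau : T -> T) f : measurable_fun setT tau -> bm f ->
  bm (f \o tau).
Proof.
move=> mtau [mf [M fM]]; split; first exact: measurableT_comp.
by exists M => x; exact: fM.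
Qed.

Lemma Ex_comp (tau : T -> T) f : measurable_fun setT tau ->
  (forall A, measurable A -> mu (tau @^-1` A) = mu A) -> bm f ->
  Ex (f \o tau) = Ex f.
Proof.
move=> mtau inv bf; rewrite /Ex /Rintegral; congr fine.
have mf := bf.1.
transitivity (\int[pushforward mu tau]_x (f x)%:E)%E; last first.
  apply: (@eq_measure_integral _ _ _ setT mu
    (measure_function_pushforward__canonical__measure_function_Measure mu mtau)).
  by move=> A mA _; exact: inv.
rewrite integral_pushforward //; first exact/measurable_EFinP.
rewrite preimage_setT (_ : _ \o _ = EFin \o (f \o tau)) //.
by apply: bm_integrable; exact: bm_comp.
Qed.

End bounded_expectation.
Notation bm := bounded_measurable.

(** * Product measures *)

Section product_measure.
Variables (R : realType) (I : choiceType).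
Local Notation UI := (unit_interval R).
Local Notation Omega := (product_space I UI).
Variable mu : probability Omega R.
Hypothesis mu_product : is_lebesgue_product mu.

Definition coord (i : I) (B : set UI) : set Omega := [set omega | B (omega i)].

Lemma measurable_coord i B : measurable B -> measurable (coord i B).
Proof.
move=> mB; apply: sub_sigma_algebra; exists i => //; exists B => //.
by rewrite setTI.
Qed.

Definition rect (F : {fset I}) (A : I -> set UI) : set Omega :=
  [set omega | forall i, i \in F -> A i (omega i)].

(** Outside [F] the sides [A] are arbitrary, so a new coordinate discards its old side, while a
    coordinate already in [F] gets an intersection. *)
Lemma rectU i F B A : rect (i |` F)%fset
  (fun j => if j == i then (if i \in F then A i `&` B else B) else A j) =
  rect F A `&` coord i B.
Proof.
apply/seteqP; split=> omega /=.
  move=> FB; split; last first.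
    by have := FB i; rewrite eqxx !inE eqxx => /(_ isT); case: ifP => // _ [].
  move=> j jF; have := FB j; rewrite !inE jF orbT => /(_ isT).
  by case: eqP => // ji; rewrite -ji jF => -[].
move=> [FA iB] j; rewrite !inE; case: eqP => /= [-> _|_ jF]; last exact: FA.
by case: ifP => // iF; split => //; exact: FA.
Qed.

Lemma measurable_rect F A : (forall i, measurable (A i)) -> measurable (rect F A).
Proof.
move=> mA; have -> : rect F A = \big[setI/setT]_(i <- F) coord i (A i).
  apply/seteqP; split=> omega; rewrite -bigcap_seq.
    by move=> FA i /= iF; exact: FA.
  by move=> FA i iF; exact: FA.
apply: big_ind => //; first exact: measurableI.
by move=> i _; exact: measurable_coord.
Qed.

Definition lam (B : set UI) : R := fine (uniform_law B).

Lemma Pr_rect F A : (forall i, measurable (A i)) ->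
  Pr mu (rect F A) = \prod_(i <- F) lam (A i).
Proof. by move=> mA; rewrite /Pr mu_product. Qed.

Lemma rect0 A : rect fset0 A = setT.
Proof. by apply/seteqP; split. Qed.

Lemma Pr_rect_coord F A i B : (forall i, measurable (A i)) -> measurable B ->
  i \notin F -> Pr mu (rect F A `&` coord i B) = lam B * Pr mu (rect F A).
Proof.
move=> mA mB iF; rewrite -rectU !Pr_rect //; last first.
  by move=> j; case: ifP => // _; case: ifP => // _; exact: measurableI.
rewrite big_fsetU1 //= eqxx (negPf iF); congr (_ * _).
by apply: eq_big_seq => j jF; case: eqP => // ji; rewrite -ji jF in iF.
Qed.

Definition centered (i : I) (B : set UI) (omega : Omega) : R :=
  \1_(coord i B) omega - lam B.

Lemma bm_centered i B : measurable B -> bm (centered i B).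
Proof.
by move=> mB; exact: bmB (bm_indic R (measurable_coord i mB)) (bm_cst _ (lam B)).
Qed.

(** The measure is given on rectangles, so each factor from [l] is split into an indicator, absorbed
    into the rectangle, minus a constant. No factor involves [i], which therefore stays out of the
    base of the rectangle and is independent of it at the end. Coordinates may repeat in [l], hence
    the intersections in [A']. *)
Lemma Ex_centered_indep i B (mB : measurable B) (l : seq (I * set UI)) F A :
  (forall i, measurable (A i)) -> i \notin F ->
  (forall p, p \in l -> p.1 != i /\ measurable p.2) ->
  Ex mu (fun omega => centered i B omega * (\1_(rect F A) omega *
    \prod_(p <- l) centered p.1 p.2 omega)) = 0.
Proof.
elim: l F A => [|p l IH] F A mA iF lP.
  have mr := measurable_rect F mA; have mc := measurable_coord i mB.
  rewrite (_ : (fun _ => _) = (fun omega => \1_(rect F A `&` coord i B) omega -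
      lam B * \1_(rect F A) omega)); last first.
    apply/funext => omega; rewrite big_nil mulr1 /centered mulrBl; congr (_ - _).
    by rewrite setIC indicI.
  rewrite ExB; [|by apply: bm_indic; exact: measurableI|exact/bmZ/bm_indic].
  rewrite ExZ; last exact: bm_indic.
  by rewrite !Ex_indic // ?Pr_rect_coord ?subrr //; exact: measurableI.
have [pi mp] := lP p (mem_head _ _).
have lP' q : q \in l -> q.1 != i /\ measurable q.2.
  by move=> ql; apply: lP; rewrite inE ql orbT.
pose A' j := if j == p.1 then (if p.1 \in F then A p.1 `&` p.2 else p.2) else A j.
have mA' j : measurable (A' j).
  by rewrite /A'; case: ifP => // _; case: ifP => // _; exact: measurableI.
pose X F A omega := centered i B omega * (\1_(rect F A) omega *
    \prod_(p <- l) centered p.1 p.2 omega).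
have bmX F' A'' : (forall i, measurable (A'' i)) -> bm (X F' A'').
  move=> mA''; apply: bmM; first exact: bm_centered.
  apply: bmM; first by apply: bm_indic; exact: measurable_rect.
  by apply: bm_prod => q /lP'[_]; exact: bm_centered.
rewrite (_ : (fun _ => _) = (fun omega => X (p.1 |` F)%fset A' omega -
   lam p.2 * X F A omega)).
  rewrite ExB; [|exact: bmX|exact/bmZ/bmX].
  have EX F' A'' : (forall i, measurable (A'' i)) -> i \notin F' ->
    Ex mu (X F' A'') = 0 by move=> *; exact: IH.
  rewrite ExZ ?EX ?mulr0 ?subr0 //; last exact: bmX.
  by rewrite !inE negb_or iF andbT eq_sym.
apply/funext => omega; rewrite /X big_cons rectU indicI /centered.
set a := \1_(coord i B) _; set b := \1_(rect F A) _; set c := \1_(coord p.1 _) _.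
by rewrite /=; ring.
Qed.

(* A term is a constant times the product over [i \in base] of the centered
   indicators of [omega i \in side i]. Terms with distinct bases are orthogonal
   in L^2; grouping the terms of a sum by base plays the role of the
   Efron-Stein decomposition. *)
Record term := Term {
  coeff : R;
  base : {fset I};
  side : I -> set UI;
  side_measurable : forall i, measurable (side i) }.

Definition term_val (t : term) (omega : Omega) : R :=
  coeff t * \prod_(i <- base t) centered i (side t i) omega.

Lemma bm_term t : bm (term_val t).
Proof. by apply/bmZ/bm_prod => i _; exact/bm_centered/side_measurable. Qed.

(** Some [i] lies in just one of the two bases; its centered factor has mean zero and is independent
    of the remaining factors, collected in [l]. *)
Lemma term_orth t t' : base t != base t' ->
  Ex mu (fun omega => term_val t omega * term_val t' omega) = 0.
Proof.
wlog [i it it'] : t t' / exists2 i, i \in base t & i \notin base t'.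
  move=> wlog_hyp tt'; have [/fsubsetP tt|] := boolP (base t `<=` base t')%fset.
    have [/fsubsetP t't|] := boolP (base t' `<=` base t)%fset.
      by case/eqP: tt'; apply/fsetP => i; apply/idP/idP; [exact: tt|exact: t't].
    move=> /fsubsetPn[i it' it].
    rewrite (_ : (fun _ => _) = (fun omega => term_val t' omega * term_val t omega)).
      by apply: wlog_hyp; rewrite 1?eq_sym //; exists i.
    by apply/funext => omega; rewrite mulrC.
  by move=> /fsubsetPn[i it it']; apply: wlog_hyp => //; exists i.
move=> _.
pose l := [seq (j, side t j) | j <- (base t `\ i)%fset] ++
          [seq (j, side t' j) | j <- base t'].
have mi := side_measurable t i.
have := @Ex_centered_indep i _ mi l fset0 (fun=> setT) (fun=> measurableT).
rewrite inE => /(_ isT) h.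
rewrite (_ : (fun _ => _) = (fun omega => (coeff t * coeff t') *
   (centered i (side t i) omega * (\1_(rect fset0 (fun=> setT)) omega *
    \prod_(p <- l) centered p.1 p.2 omega)))); last first.
  apply/funext => omega; rewrite rect0 indicT mul1r /l big_cat !big_map /=.
  rewrite /term_val (big_fsetD1 i) //=.
  set a := centered i _ _; set b := \prod_(j <- (_ `\ _)%fset) _.
  by set c := \prod_(j <- base t') _; ring.
have lP p : p \in l -> p.1 != i /\ measurable p.2.
  rewrite mem_cat => /orP[] /mapP[j jt ->] /=; split; try exact: side_measurable.
    by move: jt; rewrite !inE => /andP[].
  by apply: contraNneq it' => <-.
rewrite ExZ ?h ?mulr0 //.
apply: bmM; first exact: bm_centered.
apply: bmM; first by apply/bm_indic; rewrite rect0; exact: measurableT.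
apply: (@eq_bm _ _ _ (fun omega => \prod_(j <- (base t `\ i)%fset)
    centered j (side t j) omega * \prod_(j <- base t') centered j (side t' j) omega)).
  by move=> omega; rewrite /l big_cat !big_map.
by apply: bmM; apply: bm_prod => j _; exact/bm_centered/side_measurable.
Qed.

Definition comb (l : seq term) (omega : Omega) : R :=
  \sum_(t <- l) term_val t omega.
Definition comp (E : {fset I}) (l : seq term) (omega : Omega) : R :=
  \sum_(t <- l | base t == E) term_val t omega.

Lemma bm_comb l : bm (comb l).
Proof. by apply: bm_sum => t; exact: bm_term. Qed.

Lemma bm_compo E l : bm (comp E l).
Proof. by apply: bm_sum => t; exact: bm_term. Qed.

Definition supp_comb l : {fset {fset I}} := [fset E in [seq base t | t <- l]]%fset.

Lemma comp_out E l : E \notin supp_comb l -> comp E l = cst 0.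
Proof.
rewrite inE /= => El; apply/funext => omega; rewrite /comp.
elim: l El => [|t l IH]; first by rewrite big_nil.
by rewrite inE negb_or eq_sym big_cons => /andP[/negPf ->].
Qed.

Lemma comb_split l omega (K : {fset {fset I}}) : (supp_comb l `<=` K)%fset ->
  comb l omega = \sum_(E <- K) comp E l omega.
Proof.
move=> /fsubsetP lK; rewrite /comb /comp (exchange_big_dep xpredT) //=.
elim: l lK => [|t l IH] lK; first by rewrite !big_nil.
rewrite !big_cons IH; last first.
  by move=> E; rewrite !inE /= => El; apply: lK; rewrite !inE /= El orbT.
congr (_ + _); rewrite big_mkcond (bigD1_seq (base t)) ?fset_uniq //=.
  by rewrite eqxx big1 ?addr0 // => E; rewrite eq_sym => /negPf ->.
by apply: lK; rewrite !inE /= eqxx.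
Qed.

(** A form of Parseval's identity: orthogonality leaves only products of terms with equal bases, so
    it is enough that [K] covers the bases of [l], whatever those of [l']. *)
Lemma Ex_comb_mul l l' (K : {fset {fset I}}) : (supp_comb l `<=` K)%fset ->
  Ex mu (fun omega => comb l omega * comb l' omega) =
  \sum_(E <- K) Ex mu (fun omega => comp E l omega * comp E l' omega).
Proof.
move=> lK; rewrite (_ : (fun _ => _) = (fun omega => \sum_(E <- K)
    comp E l omega * comb l' omega)); last first.
  by apply/funext => omega; rewrite (comb_split omega lK) mulr_suml.
rewrite Ex_sum; last by move=> E; apply: bmM; [exact: bm_compo|exact: bm_comb].
apply: eq_bigr => E _; pose rest omega := \sum_(t <- l' | base t != E) term_val t omega.
have bm_rest : bm rest by apply: bm_sum => t; exact: bm_term.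
rewrite (_ : (fun _ => _) = (fun omega => comp E l omega * comp E l' omega +
    comp E l omega * rest omega)); last first.
  apply/funext => omega; rewrite -mulrDr; congr (_ * _).
  by rewrite /comb (bigID (fun t => base t == E)).
rewrite ExD; try by apply: bmM => //; exact: bm_compo.
rewrite [X in _ + X](_ : _ = 0) ?addr0 //.
rewrite (_ : (fun _ => _) = (fun omega => \sum_(t <- l | base t == E)
    \sum_(t' <- l' | base t' != E) term_val t omega * term_val t' omega)); last first.
  apply/funext => omega; rewrite mulr_suml; apply: eq_bigr => t _.
  by rewrite mulr_sumr.
rewrite Ex_sum; last first.
  by move=> t; apply: bm_sum => t'; apply: bmM; exact: bm_term.
apply: big1 => t /eqP tE; rewrite Ex_sum; last first.
  by move=> t'; apply: bmM; exact: bm_term.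
by apply: big1 => t' t'E; rewrite term_orth // tE eq_sym.
Qed.

Definition rects : set (set Omega) :=
  [set X | exists F A, (forall i, measurable (A i)) /\ X = rect F A].

Lemma rects_measurable : @measurable _ Omega = <<s rects>>.
Proof.
apply/seteqP; split.
  apply: smallest_sub; first exact: smallest_sigma_algebra.
  move=> _ [i _ [B mB <-]]; rewrite setTI; apply: sub_sigma_algebra.
  exists [fset i]%fset, (fun=> B); split => //.
  apply/seteqP; split => omega /=.
    by move=> iB j; rewrite inE => /eqP ->.
  by apply; rewrite inE.
apply: smallest_sub; first exact: sigma_algebra_measurable.
by move=> _ [F [A [mA ->]]]; exact: measurable_rect.
Qed.

Lemma rects_setI_closed : setI_closed rects.
Proof.
move=> _ _ [F [A [mA ->]]] [F' [A' [mA' ->]]].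
exists (F `|` F')%fset, (fun i => (if i \in F then A i else setT) `&`
  (if i \in F' then A' i else setT)); split.
  by move=> i; apply: measurableI; case: ifP.
apply/seteqP; split => omega /=.
  move=> [FA F'A'] i _.
  by split; case: ifP => // ?; [exact: FA|exact: F'A'].
move=> FF'; split => i iF; have := FF' i; rewrite inE iF ?orbT => /(_ isT) [] //.
Qed.

Lemma product_dynkin (P : set_system Omega) :
  (forall F A, (forall i, measurable (A i)) -> P (rect F A)) ->
  (forall X, measurable X -> P X -> P (~` X)) ->
  (forall F : (set Omega)^nat, (forall n, measurable (F n)) ->
    trivIset setT F -> (forall n, P (F n)) -> P (\bigcup_k F k)) ->
  forall X, measurable X -> P X.
Proof.
move=> Prect PC PU X; rewrite rects_measurable => mX.
apply: (dynkin_induction rects_measurable rects_setI_closed) mX => //.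
  by rewrite -(rect0 (fun=> setT)); exact: Prect.
by move=> _ [F [A [mA ->]]]; exact: Prect.
Qed.

End product_measure.

(** * Approximation by sums of centered products *)

Section approximation.
Variables (R : realType) (I : choiceType).
Local Notation UI := (unit_interval R).
Local Notation Omega := (product_space I UI).
Variable mu : probability Omega R.
Hypothesis mu_product : is_lebesgue_product mu.
Local Notation term := (term R I).
Implicit Types (l : seq term) (omega : Omega).

(** Such combinations are orthogonal to the constants, on which no gap can hold. *)
Definition noncst (l : seq term) := all (fun t => base t != fset0) l.

Lemma noncst_supp l : noncst l -> fset0 \notin supp_comb l.
Proof.
rewrite !inE /=; elim: l => //= t l IH /andP[t0 /IH l0].
by rewrite inE negb_or eq_sym t0.
Qed.

Lemma comb_cat l l' omega :
  comb (l ++ l') omega = comb l omega + comb l' omega :> R.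
Proof. by rewrite /comb big_cat. Qed.

Definition scale_term c (t : term) :=
  Term (c * coeff t) (base t) (side_measurable t).

Lemma comb_scale c l omega :
  comb [seq scale_term c t | t <- l] omega = c * comb l omega :> R.
Proof.
by rewrite /comb big_map mulr_sumr; apply: eq_bigr => t _; rewrite /term_val mulrA.
Qed.

Lemma noncst_scale c l : noncst [seq scale_term c t | t <- l] = noncst l.
Proof. by rewrite /noncst all_map. Qed.

Definition times_term (i : I) (B : set UI) (mB : measurable B) (t : term) : term.
Proof.
refine (@Term R I (coeff t) (i |` base t)%fset
  (fun j => if j == i then B else side t j) _).
by move=> j; case: ifP => // _; exact: side_measurable.
Defined.

Lemma times_termE (i : I) (B : set UI) (mB : measurable B) t omega : i \notin base t ->
  term_val (times_term i mB t) omega = centered i B omega * term_val t omega.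
Proof.
move=> it; rewrite /term_val /= big_fsetU1 //= eqxx mulrCA; congr (_ * (_ * _)).
by apply: eq_big_seq => j jt; case: eqP => // ji; rewrite -ji jt in it.
Qed.

(** Each indicator is [lam] plus a centered indicator; multiplying out, the constant is the
    probability of the rectangle. Keeping the bases inside [r] ensures that the next coordinate is
    new, as [times_termE] requires. *)
Lemma rect_expansion (A : I -> set UI) (mA : forall i, measurable (A i))
    (r : seq I) : uniq r ->
  exists2 l : seq term,
    all (fun t => (base t != fset0) && all (mem r) (base t)) l &
    forall omega, \prod_(i <- r) \1_(coord i (A i)) omega =
      \prod_(i <- r) lam (A i) + comb l omega :> R.
Proof.
elim: r => [_|i r IH /= /andP[ir /IH[l lr lE]]].
  by exists [::] => // omega; rewrite !big_nil /comb big_nil addr0.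
pose t0 := Term (\prod_(i <- r) lam (A i)) [fset i]%fset mA.
exists (t0 :: [seq times_term i (mA i) t | t <- l] ++
        [seq scale_term (lam (A i)) t | t <- l]).
  rewrite /= all_cat !all_map.
  have -> : [fset i]%fset != fset0 by rewrite -cardfs_eq0 cardfs1.
  have -> : all (mem (i :: r)) [fset i]%fset.
    by apply/allP => j; rewrite !inE => /eqP ->; rewrite eqxx.
  rewrite /=; apply/andP; split; apply: sub_all lr => t /= /andP[t0n /allP tr].
    apply/andP; split; last first.
      by apply/allP => j; rewrite !inE => /orP[-> //|/tr /= ->]; rewrite orbT.
    by apply/eqP => /fsetP /(_ i); rewrite !inE eqxx.
  rewrite t0n; apply/allP => j /tr; rewrite !inE => ->; exact: orbT.
move=> omega; rewrite !big_cons lE /comb big_cons big_cat /= -!/(comb _ _).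
rewrite comb_scale.
have -> : comb [seq times_term i (mA i) t | t <- l] omega =
    centered i (A i) omega * comb l omega.
  rewrite /comb big_map mulr_sumr.
  elim: (l) lr => [|t l' IH']; first by rewrite !big_nil.
  move=> /= /andP[/andP[_ /allP tr] /IH' IHl].
  rewrite !big_cons IHl times_termE //.
  by apply/negP => /tr; rewrite /= (negPf ir).
rewrite /term_val /= big_seq_fset1 /centered.
set a := \1_(_) _; set b := \prod_(_ <- _) _; set c := comb l omega.
by ring.
Qed.

(** Membership in the L^2-closure of the span of the terms with nonempty base. *)
Definition approx (f : Omega -> R) := bm f /\ forall e : R, 0 < e ->
  exists2 l, noncst l & nrm mu (fun omega => f omega - comb l omega) <= e.

Lemma approxD f g : approx f -> approx g -> approx (fun x => f x + g x).
Proof.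
move=> [bf af] [bg ag]; split; first exact: bmD.
move=> e e0; have e2 : 0 < e / 2 by rewrite divr_gt0.
have [l l0 fl] := af _ e2; have [l' l'0 gl'] := ag _ e2.
exists (l ++ l'); first by rewrite /noncst all_cat; apply/andP.
rewrite (@eq_nrm _ _ _ mu _
    (fun x => (f \- comb l) x + (g \- comb l') x)); last first.
  by move=> x; rewrite comb_cat /=; ring.
apply: le_trans (nrmD mu (bmB bf (bm_comb l)) (bmB bg (bm_comb l'))) _.
by rewrite [leRHS](splitr e) lerD.
Qed.

Lemma approxZ c f : approx f -> approx (fun x => c * f x).
Proof.
move=> [bf af]; split; first exact: bmZ.
move=> e e0.
have [l l0 fl] := af _ (divr_gt0 e0 (ltr_pwDr ltr01 (normr_ge0 c))).
exists [seq scale_term c t | t <- l]; first by rewrite noncst_scale.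
rewrite (_ : (fun x => _) = (fun x => c * (f x - comb l x))); last first.
  by apply/funext => x; rewrite comb_scale mulrBr.
rewrite nrmZ; last exact: bmB bf (bm_comb l).
have c1 : 0 < `|c| + 1 by rewrite ltr_pwDr.
apply: (@le_trans _ _ ((`|c| + 1) * (e / (`|c| + 1)))); last first.
  by rewrite mulrCA divff ?mulr1 // gt_eqF.
by apply: ler_pM => //; [exact: nrm_ge0|rewrite lerDl].
Qed.

Lemma approx_sum (n : nat) (F : nat -> Omega -> R) :
  (forall i, approx (F i)) -> approx (fun x => \sum_(i < n) F i x).
Proof.
move=> aF; elim: n => [|n IH].
  have := approxZ 0 (aF 0%N); congr approx.
  by apply/funext => x; rewrite big_ord0 mul0r.
have := approxD IH (aF n); congr approx.
by apply/funext => x; rewrite big_ord_recr.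
Qed.

Lemma approx_lim f : bm f ->
  (forall e, 0 < e -> exists2 g, approx g & nrm mu (fun x => f x - g x) <= e) ->
  approx f.
Proof.
move=> bf lim; split => // e e0; have e2 : 0 < e / 2 by rewrite divr_gt0.
have [g [bg ag] fg] := lim _ e2; have [l l0 gl] := ag _ e2; exists l => //.
rewrite (@eq_nrm _ _ _ mu _ (fun x => (f \- g) x + (g \- comb l) x)); last first.
  by move=> x /=; ring.
apply: le_trans (nrmD mu (bmB bf bg) (bmB bg (bm_comb l))) _.
by rewrite [leRHS](splitr e) lerD.
Qed.

Definition cind (A : set Omega) (omega : Omega) : R := \1_A omega - Pr mu A.

Lemma bm_cind A : measurable A -> bm (cind A).
Proof. by move=> mA; exact: bmB (bm_indic R mA) (bm_cst _ _). Qed.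

Lemma Ex_cind_mul A B : measurable A -> measurable B ->
  Ex mu (fun x => cind A x * cind B x) = Pr mu (A `&` B) - Pr mu A * Pr mu B.
Proof.
move=> mA mB; rewrite (_ : (fun x => _) = (fun x => (\1_(A `&` B) x -
    Pr mu A * \1_B x) - Pr mu B * cind A x)); last first.
  by apply/funext => x; rewrite /cind indicI /=; ring.
have bA := bm_indic R mA; have bB := bm_indic R mB.
have bAB := bm_indic R (measurableI _ _ mA mB).
rewrite ExB; [|exact: bmB bAB (bmZ _ bB)|exact: bmZ (bm_cind mA)].
rewrite ExB //; last exact: bmZ.
rewrite !ExZ //; last exact: bm_cind.
rewrite ExB //; last exact: bm_cst.
by rewrite Ex_cst !Ex_indic //; [ring|exact: measurableI].
Qed.

Lemma nrm_cind A : measurable A -> nrm mu (cind A) ^+ 2 = Pr mu A * (1 - Pr mu A).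
Proof.
move=> mA; rewrite nrm_sqr (_ : (fun x => _) = (fun x => cind A x * cind A x)).
  by rewrite Ex_cind_mul // setIid; ring.
by apply/funext => x; rewrite expr2.
Qed.

(** On rectangles [rect_expansion] is exact, and complementation changes the sign of [cind]. For a
    disjoint union, the error after [n] sets is [cind] of the tail [B n]; its squared norm is at
    most the probability of [B n], which tends to 0 because the tails decrease to the empty set. *)
Lemma approx_cind A : measurable A -> approx (cind A).
Proof.
move: A; apply: product_dynkin.
- move=> F A mA; apply: approx_lim; first by apply/bm_cind; exact: measurable_rect.
  have [l lF lE] := rect_expansion mA (fset_uniq F).
  move=> e e0; exists (comb l).
    split; first exact: bm_comb.
    move=> e' e'0; exists l; first by apply: sub_all lF => t /andP[].
    rewrite (_ : (fun _ => _) = cst 0); last by apply/funext => x; rewrite subrr.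
    by rewrite /nrm (_ : (fun x => _) = cst 0) ?Ex_cst ?sqrtr0 ?ltW //;
      apply/funext => x; rewrite expr0n.
  rewrite (_ : (fun _ => _) = cst 0); last first.
    apply/funext => x; rewrite /cind Pr_rect // -addrA -opprD -lE.
    apply/eqP; rewrite subr_eq0; apply/eqP; rewrite indicE.
    have [xA|xA] := pselect (rect F A x).
      rewrite mem_set // big_seq big1 // => i iF; rewrite indicE mem_set //; exact: xA.
    have [i [iF xi]] : exists i, i \in F /\ ~ A i (x i).
      apply: contrapT => h; apply: xA => i iF; apply: contrapT => nA.
      by apply: h; exists i.
    by rewrite memNset // (big_fsetD1 i) //= indicE memNset // mul0r.
  by rewrite /nrm (_ : (fun x => _) = cst 0) ?Ex_cst ?sqrtr0 ?ltW //;
      apply/funext => x; rewrite expr0n.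
- move=> A mA /(approxZ (-1)); congr approx; apply/funext => x.
  rewrite /cind PrC // !indicE in_setC.
  by case: (x \in A) => /=; ring.
- move=> F mF tF aF; have mU : measurable (\bigcup_k F k) by exact: bigcup_measurable.
  apply: approx_lim; first exact: bm_cind.
  move=> e e0.
  pose B n := \bigcup_(k >= n) F k.
  have mB n : measurable (B n) by apply: bigcup_measurable => k _; exact: mF.
  have capB : \bigcap_n B n = set0.
    apply/seteqP; split => // x Bx; have [k _ Fk] := Bx 0%N Logic.I.
    have [k' /= kk' Fk'] := Bx k.+1 Logic.I.
    by have := tF k k' Logic.I Logic.I (ex_intro _ x (conj Fk Fk')) => kk; rewrite kk ltnn in kk'.
  have [n Bn] : exists n, Pr mu (B n) <= e ^+ 2.
    have cvgB : (mu \o B) n @[n --> \oo] --> mu (\bigcap_n B n).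
      apply: nonincreasing_cvg_mu => //.
      - exact: (le_lt_trans (probability_le1 mu (mB 0%N)) (ltry 1)).
      - by rewrite capB.
      - move=> m n mn; apply/subsetPset => x [k /= nk Fk].
        by exists k => //=; exact: leq_trans nk.
    rewrite capB measure0 in cvgB.
    have /fine_cvgP[_ /cvgrPdist_le cvgB'] := cvgB.
    have [N _ /(_ N (leqnn N)) /=] := cvgB' _ (exprn_gt0 2 e0).
    by rewrite sub0r normrN ger0_norm ?Pr_ge0 // => ?; exists N.
  exists (fun x => \sum_(i < n) cind (F i) x).
    exact: (@approx_sum n (fun i => cind (F i))).
  have -> : (fun x => cind (\bigcup_k F k) x - \sum_(i < n) cind (F i) x) =
      cind (B n).
    have key x : \1_(\bigcup_k F k) x - \sum_(i < n) \1_(F i) x = \1_(B n) x :> R.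
      have tFx i j : F i x -> F j x -> i = j.
        by move=> Fi Fj; apply: (tF i j) => //; exists x.
      have [[k _ Fk]|nU] := pselect ((\bigcup_k F k) x); last first.
        rewrite !indicE memNset // memNset; last by case=> k _ Fk; apply: nU; exists k.
        by rewrite big1 ?subr0 // => i _; rewrite indicE memNset // => Fi; apply: nU; exists i.
      rewrite [\1_(\bigcup_k _) x]indicE mem_set; last by exists k.
      have [nk|kn] := leqP n k.
        rewrite indicE mem_set; last by exists k.
        rewrite big1 ?subr0 // => i _; rewrite indicE memNset // => /(tFx _ _ Fk) ki.
        by rewrite ki leqNgt ltn_ord in nk.
      rewrite [RHS]indicE memNset; last first.
        by move=> [j /= nj /(tFx _ _ Fk) kj]; rewrite kj ltnNge nj in kn.
      rewrite (bigD1 (Ordinal kn)) //= indicE mem_set // big1 ?addr0 ?subrr //.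
      move=> i ik; rewrite indicE memNset // => /(tFx _ _ Fk) ki.
      by move/eqP: ik; apply; apply: val_inj.
    have bI A : measurable A -> bm (\1_A : Omega -> R) by exact: bm_indic.
    have PrB : Pr mu (\bigcup_k F k) - \sum_(i < n) Pr mu (F i) = Pr mu (B n).
      rewrite -(Ex_indic mu (mB n)) -(Ex_indic mu mU).
      under eq_bigr do rewrite -Ex_indic //.
      rewrite -Ex_sum; last by move=> i; exact: bI.
      rewrite -ExB; [|exact: bI|by apply: bm_sum => i; exact: bI].
      by congr Ex; apply/funext.
    by apply/funext => x; rewrite /cind -PrB -key sumrB; ring.
  rewrite -ler_sqr ?nnegrE ?nrm_ge0 ?(ltW e0) // nrm_cind //.
  apply: le_trans Bn; rewrite ler_piMr ?Pr_ge0 // lerBlDr lerDl; exact: Pr_ge0.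
Qed.

End approximation.

(** * Expansion in the Bernoulli shift *)

Section translation_gap.
Variables (R : realType) (Gamma : groupType).
Local Notation UI := (unit_interval R).
Local Notation Omega := (product_space Gamma UI).
Variable mu : probability Omega R.
Hypothesis mu_product : is_lebesgue_product mu.
Local Notation term := (term R Gamma).
Implicit Types (l : seq term) (omega : Omega) (s : Gamma) (f g : Omega -> R).

(** Translation is on the right because neighbours are left multiples: [tau s] is the action of the
    automorphism [right_aut s] introduced below. *)
Definition tau s omega : Omega := fun y => omega (y * s)%g.

Lemma measurable_tau s : measurable_fun setT (tau s).
Proof.
apply: (@measurability _ _ _ _ setT (tau s) (@coordinate_sets Gamma _ UI)) => //.
move=> _ [_ [i _ [B mB <-]] <-]; rewrite !setTI.
exact: (measurable_coord (i * s)%g mB).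
Qed.

Lemma measurable_tauP s (A : set Omega) : measurable A -> measurable (tau s @^-1` A).
Proof. by move=> mA; rewrite -[X in measurable X]setTI; exact: measurable_tau. Qed.

Lemma mu_tau s (A : set Omega) : measurable A -> mu (tau s @^-1` A) = mu A.
Proof.
move: A; apply: product_dynkin.
- move=> F A mA.
  have -> : tau s @^-1` (rect F A) = rect (rtrans F s) (fun j => A (j * s^-1)%g).
    apply/seteqP; split => omega /= FA i.
      by move=> /imfsetP[j /= jF ->]; rewrite mulgK; exact: FA.
    by move=> iF; have := FA (i * s)%g; rewrite mulgK mem_rtrans; exact.
  rewrite !mu_product // big_imfset /=; last by move=> x y _ _; exact: mulIg.
  by congr (_%:E); apply: eq_bigr => i _; rewrite mulgK.
- move=> A mA IH; rewrite preimage_setC !probability_setC ?IH //.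
  exact: measurable_tauP.
- move=> F mF tF IH; rewrite preimage_bigcup !measure_bigcup //.
  + by apply: eq_eseriesr => i _; exact: IH.
  + by move=> i _; exact: measurable_tauP.
  + move=> i j _ _ [x [Fi Fj]]; apply: (tF i j) => //; by exists (tau s x).
Qed.

Lemma Pr_tau s (A : set Omega) : measurable A -> Pr mu (tau s @^-1` A) = Pr mu A.
Proof. by move=> mA; rewrite /Pr mu_tau. Qed.

Lemma bm_tau s f : bm f -> bm (f \o tau s).
Proof. by move=> bf; apply: bm_comp bf; exact: measurable_tau. Qed.

Lemma nrm_tau s f : bm f -> nrm mu (f \o tau s) = nrm mu f.
Proof.
move=> bf; rewrite /nrm; congr Num.sqrt.
exact: (Ex_comp (measurable_tau s) (mu_tau s) (bm_sqr bf)).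
Qed.

Definition shift_term s (t : term) : term :=
  Term (coeff t) (rtrans (base t) s)
    (fun i => side_measurable t (i * s^-1)%g).

Lemma shift_termE s t omega :
  term_val (shift_term s t) omega = term_val t (tau s omega).
Proof.
rewrite /term_val /= big_imfset /=; last by move=> x y _ _; exact: mulIg.
by congr (_ * _); apply: eq_bigr => i _; rewrite mulgK.
Qed.

Lemma comb_shift s l omega :
  comb [seq shift_term s t | t <- l] omega = comb l (tau s omega).
Proof. by rewrite /comb big_map; apply: eq_bigr => t _; exact: shift_termE. Qed.

Lemma comp_shift s l E omega :
  comp E [seq shift_term s t | t <- l] omega =
  comp (rtrans E s^-1%g) l (tau s omega).
Proof.
rewrite /comp big_map; apply: eq_big => [t|t _]; last exact: shift_termE.
by rewrite /= -{1}(rtransVK s E) (inj_eq (can_inj (rtransK s))).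
Qed.

Lemma nrm0 : nrm mu (cst 0) = 0.
Proof.
rewrite /nrm (_ : (fun x => _) = cst 0) ?Ex_cst ?sqrtr0 //.
by apply/funext => x; rewrite expr0n.
Qed.

Variables (S : {fset Gamma}) (C : R).
Hypothesis C_ge0 : 0 <= C.
Hypothesis gap : forall (h : Gamma -> R) (Y : {fset Gamma}),
    (forall x, x \notin Y -> h x = 0) -> (forall x, 0 <= h x) ->
    \sum_(x <- Y) \sum_(s <- S) h x * h (s * x)%g <=
    C * \sum_(x <- Y) h x ^+ 2.

(** This is [|S|] times the quadratic form of the averaging operator of the shift over [S]. *)
Definition corr f := \sum_(s <- S) Ex mu (fun x => f x * f (tau s x)).

(** The part of the translate over [E] is the translate of the part over [E s^-1]. By orthogonality
    and Cauchy-Schwarz only the norms [a E] matter, and they form a nonnegative function on nonempty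
    finite sets, where the gap holds. *)
Lemma corr_comb l : noncst l -> `|corr (comb l)| <= C * nrm mu (comb l) ^+ 2.
Proof.
move=> l0; set K := supp_comb l.
pose a E := nrm mu (comp E l).
have aK E : E \notin K -> a E = 0 by move=> /comp_out El; rewrite /a El nrm0.
have normE : nrm mu (comb l) ^+ 2 = \sum_(E <- K) a E ^+ 2.
  have sqrE f : Ex mu (fun x => f x ^+ 2) = Ex mu (fun x => f x * f x).
    by congr (Ex mu _); apply/funext => x; rewrite expr2.
  rewrite nrm_sqr sqrE (Ex_comb_mul mu_product l (fsubset_refl K)).
  by apply: eq_bigr => E _; rewrite nrm_sqr sqrE.
rewrite normE.
have := gap_on_finite_sets gap (noncst_supp l0) aK (fun E => nrm_ge0 _ _).
apply: le_trans; rewrite /corr exchange_big /=.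
apply: (le_trans (ler_norm_sum _ _ _)); apply: ler_sum => s _.
rewrite (_ : (fun x => _) =
    (fun x => comb l x * comb [seq shift_term s t | t <- l] x)); last first.
  by apply/funext => x; rewrite comb_shift.
rewrite (Ex_comb_mul mu_product _ (fsubset_refl K)).
apply: (le_trans (ler_norm_sum _ _ _)); apply: ler_sum => E _.
rewrite (_ : (fun x => _) =
    (fun x => comp E l x * (comp (rtrans E s^-1%g) l \o tau s) x)); last first.
  by apply/funext => x; rewrite comp_shift.
rewrite /a -[X in _ <= _ * X](nrm_tau s); last exact: bm_compo.
by apply: cauchy_schwarz_norm; [exact: bm_compo|exact/bm_tau/bm_compo].
Qed.

Lemma corr_approx f : approx mu f -> `|corr f| <= C * nrm mu f ^+ 2.
Proof.
move=> [bf af]; set n := nrm mu f; have n0 : 0 <= n := nrm_ge0 _ _.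
pose d : R := #|` S|%:R; have d0 : 0 <= d := ler0n _ _.
(* When [f] is replaced by a combination at distance [e <= 1], the squared norm and each summand of
   [corr] move by at most [(2 * n + 1) * e]: the factor [C] pays for the former, [d] for the
   latter. *)
pose M := (C + d) * (2 * n + 1).
have M0 : 0 <= M by rewrite mulr_ge0 ?addr_ge0 ?mulr_ge0.
suff key e : 0 < e -> e <= 1 -> `|corr f| <= C * n ^+ 2 + M * e.
  apply/ler_addgt0Pr => e e0; have M1 : 0 < M + 1 by rewrite ltr_pwDr.
  pose e' := Num.min 1 (e / (M + 1)).
  have e'0 : 0 < e' by rewrite lt_min ltr01 divr_gt0.
  have e'1 : e' <= 1 by rewrite ge_min lexx.
  apply: (le_trans (key e' e'0 e'1)); rewrite lerD2l.
  apply: (@le_trans _ _ ((M + 1) * e')); first by rewrite ler_pM2r // lerDl.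
  by rewrite mulrC -ler_pdivlMr // /e' ge_min lexx orbT.
move=> e0 e1; have [l l0 fl] := af e e0.
set F := comb l in fl; pose r x := f x - F x.
have bF : bm F := bm_comb l.
have br : bm r := bmB bf bF.
have r0 : 0 <= nrm mu r := nrm_ge0 _ _.
have nF : nrm mu F <= n + e.
  rewrite (@eq_nrm _ _ _ mu F (fun x => f x + (- r x))); last first.
    by move=> x; rewrite /r; ring.
  by rewrite (le_trans (nrmD mu bf (bmN br))) // lerD2l nrmN.
have F0 : 0 <= nrm mu F := nrm_ge0 _ _.
have diff s : `|Ex mu (fun x => f x * f (tau s x)) -
    Ex mu (fun x => F x * F (tau s x))| <= (2 * n + 1) * e.
  have bt g g' : bm g -> bm g' -> bm (fun x => g x * g' (tau s x)).
    by move=> bg bg'; exact: bmM bg (bm_tau s bg').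
  have -> : Ex mu (fun x => f x * f (tau s x)) -
      Ex mu (fun x => F x * F (tau s x)) =
      Ex mu (fun x => r x * (f \o tau s) x) + Ex mu (fun x => F x * (r \o tau s) x).
    rewrite -ExB; [|exact: bt|exact: bt].
    rewrite -ExD; [|exact: bt|exact: bt].
    by congr Ex; apply/funext => x; rewrite /r /=; ring.
  apply: (le_trans (ler_normD _ _)).
  have h1 := cauchy_schwarz_norm mu br (bm_tau s bf).
  have h2 := cauchy_schwarz_norm mu bF (bm_tau s br).
  rewrite !nrm_tau // -/n in h1 h2.
  have h3 : nrm mu r * n <= e * n by rewrite ler_wpM2r.
  have h4 : nrm mu F * nrm mu r <= (n + 1) * e.
    by apply: ler_pM => //; apply: (le_trans nF); rewrite lerD2l.
  lra.
have corrD : `|corr f| <= `|corr F| + d * ((2 * n + 1) * e).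
  rewrite -lerBlDl; apply: (le_trans (lerB_dist _ _)).
  rewrite /corr -sumrB; apply: (le_trans (ler_norm_sum _ _ _)).
  apply: (@le_trans _ _ (\sum_(s <- S) (2 * n + 1) * e)).
    by apply: ler_sum => s _; exact: diff.
  by rewrite big_const_seq count_predT iter_addr_0 -[X in X <= _]mulr_natl.
apply: (le_trans corrD).
have cF := corr_comb l0; rewrite -/F in cF.
have h5 : C * nrm mu F ^+ 2 <= C * (n + e) ^+ 2.
  by rewrite ler_wpM2l // ler_sqr ?nnegrE ?addr_ge0 ?(ltW e0).
have h6 : C * (n + e) ^+ 2 <= C * n ^+ 2 + C * ((2 * n + 1) * e).
  rewrite -mulrDr ler_wpM2l // -subr_ge0.
  have -> : n ^+ 2 + (2 * n + 1) * e - (n + e) ^+ 2 = e * (1 - e) by ring.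
  by rewrite mulr_ge0 ?(ltW e0) // subr_ge0.
have -> : M * e = C * ((2 * n + 1) * e) + d * ((2 * n + 1) * e).
  by rewrite /M; ring.
lra.
Qed.

(* Polarization of [corr] at [(1 - q) (1_A - p)] and [p (1_B - q)]. *)
Lemma expansion (A B : set Omega) : measurable A -> measurable B ->
  (forall s, s \in S -> A `&` tau s @^-1` B = set0) ->
  (forall s, s \in S -> B `&` tau s @^-1` A = set0) ->
  let p := Pr mu A in let q := Pr mu B in 0 < p -> q < 1 ->
  2 * #|` S|%:R * (p * q) <= C * (p * q + (1 - p) * (1 - q)).
Proof.
move=> mA mB AB BA p q p0 q1.
(* With these weights both sides acquire the factor [2 * p * (1 - q)], cancelled at the end. The
   outcome is what [|S| p q <= C sqrt(p q (1 - p) (1 - q))] would give after the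
   arithmetic-geometric mean inequality, without any square root. *)
pose f1 x := (1 - q) * cind mu A x; pose f2 x := p * cind mu B x.
have a1 : approx mu f1 by exact/approxZ/approx_cind.
have a2 : approx mu f2 by exact/approxZ/approx_cind.
have a2N : approx mu (fun x => -1 * f2 x) by exact: approxZ.
have [b1 _] := a1; have [b2 _] := a2.
have ap := approxD a1 a2; have am := approxD a1 a2N.
(* Disjointness kills the product of the indicators, so the covariance is minus the product of the
   probabilities. *)
have cross c c' X Y s : measurable X -> measurable Y -> X `&` tau s @^-1` Y = set0 ->
   Ex mu (fun x => (c * cind mu X x) * (c' * cind mu Y (tau s x))) =
   - (c * c' * (Pr mu X * Pr mu Y)).
  move=> mX mY XY; have mtY := measurable_tauP s mY.
  rewrite (_ : (fun x => _) = (fun x => (c * c') *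
     (cind mu X x * cind mu (tau s @^-1` Y) x))); last first.
    apply/funext => x; rewrite /cind Pr_tau //.
    have -> : \1_(tau s @^-1` Y) x = \1_Y (tau s x) :> R; last by ring.
    rewrite !indicE; have [Yx|nYx] := pselect (Y (tau s x)).
      by rewrite !mem_set.
    by rewrite !memNset.
  rewrite ExZ; last by apply: bmM; exact: bm_cind.
  by rewrite Ex_cind_mul // XY Pr0 Pr_tau // sub0r mulrN.
have bt s g g' : bm g -> bm g' -> bm (fun x => g x * g' (tau s x)).
  by move=> bg bg'; exact: bmM bg (bm_tau s bg').
have diff : corr (fun x => f1 x + f2 x) - corr (fun x => f1 x + -1 * f2 x) =
    - (#|` S|%:R * (4 * ((1 - q) * p * (p * q)))).
  rewrite /corr -sumrB (eq_big_seq (fun=> - (4 * ((1 - q) * p * (p * q))))).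
    by rewrite big_const_seq count_predT iter_addr_0 -[LHS]mulr_natl mulrN.
  move=> s sS; have [c1 c2] := (AB s sS, BA s sS).
  rewrite -ExB; [|exact: (bt s _ _ ap.1 ap.1)|exact: (bt s _ _ am.1 am.1)].
  rewrite (_ : (fun x => _) = (fun x => 2 * (f1 x * f2 (tau s x)) +
     2 * (f2 x * f1 (tau s x)))); last by apply/funext => x /=; ring.
  rewrite ExD; [|exact/bmZ/bt|exact/bmZ/bt].
  rewrite !ExZ; [|exact/bt|exact/bt].
  rewrite /f1 /f2 !cross // /p /q; ring.
have para : nrm mu (fun x => f1 x + f2 x) ^+ 2 +
    nrm mu (fun x => f1 x + -1 * f2 x) ^+ 2 =
    2 * ((1 - q) ^+ 2 * (p * (1 - p)) + p ^+ 2 * (q * (1 - q))).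
  rewrite !nrm_sqr -ExD; [|exact: bm_sqr ap.1|exact: bm_sqr am.1].
  rewrite (_ : (fun x => _) = (fun x => 2 * f1 x ^+ 2 + 2 * f2 x ^+ 2)); last first.
    by apply/funext => x; ring.
  rewrite ExD; [|exact/bmZ/bm_sqr|exact/bmZ/bm_sqr].
  rewrite !ExZ; [|exact/bm_sqr|exact/bm_sqr].
  rewrite -!nrm_sqr /f1 /f2 !nrmZ; [|exact: bm_cind|exact: bm_cind].
  by rewrite !exprMn !nrm_cind // !real_normK ?num_real // -/p -/q; ring.
have h1 := corr_approx ap; have h2 := corr_approx am.
have h3 : 4 * (#|` S|%:R * ((1 - q) * p * (p * q))) <=
    C * (nrm mu (fun x => f1 x + f2 x) ^+ 2 +
    nrm mu (fun x => f1 x + -1 * f2 x) ^+ 2).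
  move: h1 h2; rewrite !ler_norml => /andP[h1 _] /andP[_ h2].
  rewrite mulrDr; move: diff h1 h2.
  set c1 := corr _; set c2 := corr _; set n1 := C * _; set n2 := C * _.
  set K := #|` S|%:R; set z := (1 - q) * p * (p * q).
  have -> : K * (4 * z) = 4 * (K * z) by ring.
  lra.
rewrite para in h3.
have pq0 : 0 < 2 * (p * (1 - q)) by rewrite !mulr_gt0 // subr_gt0.
rewrite -(ler_pM2l pq0).
by move: h3; congr (_ <= _); ring.
Qed.

End translation_gap.

(** * Measurable predicates and labels *)

Lemma countable_inj (T : Type) (U : countType) (f : T -> U) :
  injective f -> countable [set: T].
Proof.
have /countable_injP[g g_inj] := countableP [set: U].
move=> f_inj; apply/countable_injP; exists (g \o f) => x y _ _ /g_inj gxy.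
by apply/f_inj/gxy; rewrite inE.
Qed.

Section measurable_predicates.
Context d (T : measurableType d).
Implicit Types P Q : T -> Prop.

Definition mpred P := measurable [set x | P x].

Lemma eq_mpred P Q : (forall x, P x <-> Q x) -> mpred P -> mpred Q.
Proof.
move=> PQ; rewrite /mpred (_ : [set x | P x] = [set x | Q x]) //.
by apply/seteqP; split=> x /PQ.
Qed.

Lemma mpred_cst (A : Prop) : mpred (fun=> A).
Proof.
have [a|na] := pselect A.
  by apply: eq_mpred (@measurableT _ T) => x; split.
by apply: eq_mpred (@measurable0 _ T) => x; split.
Qed.

Lemma mpred_not P : mpred P -> mpred (fun x => ~ P x).
Proof. exact: measurableC. Qed.

Lemma mpred_and P Q : mpred P -> mpred Q -> mpred (fun x => P x /\ Q x).
Proof. exact: measurableI. Qed.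

Lemma mpred_or P Q : mpred P -> mpred Q -> mpred (fun x => P x \/ Q x).
Proof. exact: measurableU. Qed.

Lemma mpred_imply P Q : mpred P -> mpred Q -> mpred (fun x => P x -> Q x).
Proof.
move=> mP mQ; apply: eq_mpred (mpred_or (mpred_not mP) mQ) => x.
by split => [[nP /nP //|Qx _ //]|PQ]; have [/PQ|] := pselect (P x); [right|left].
Qed.

Lemma mpred_ex (U : Type) (P : U -> T -> Prop) : countable [set: U] ->
  (forall u, mpred (P u)) -> mpred (fun x => exists u, P u x).
Proof.
move=> cU mP; apply: eq_mpred (countable_bigcupT_measurable cU mP) => x.
by split => [[u _ Pu]|[u Pu]]; exists u.
Qed.

Lemma mpred_ex2 (U : Type) (P Q : U -> T -> Prop) : countable [set: U] ->
  (forall u, mpred (P u)) -> (forall u, mpred (Q u)) ->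
  mpred (fun x => exists2 u, P u x & Q u x).
Proof.
move=> cU mP mQ; apply: eq_mpred (mpred_ex cU (fun u => mpred_and (mP u) (mQ u))).
by move=> x; split=> [[u [? ?]]|[u]]; exists u.
Qed.

Lemma mpred_all (U : Type) (P : U -> T -> Prop) : countable [set: U] ->
  (forall u, mpred (P u)) -> mpred (fun x => forall u, P u x).
Proof.
move=> cU mP; apply: eq_mpred (mpred_not (mpred_ex cU (fun u => mpred_not (mP u)))).
move=> x; split=> [nex u|all [u]]; last by apply; exact: all.
by apply: contrapT => nP; apply: nex; exists u.
Qed.

End measurable_predicates.

Section countable_group.
Variables (Gamma : groupType) (S : {fset Gamma}).
Hypothesis S_sym : {in S, forall s, s^-1%g \in S}.
Hypothesis S_gen : generates S.

Lemma generated_countable : countable [set: Gamma].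
Proof.
pose f (w : seq S) : Gamma := foldr (fun (s : S) x => (val s * x)%g) 1%g w.
have f_cat w w' : f (w ++ w') = (f w * f w')%g.
  by elim: w => [|s w IH] /=; rewrite ?mul1g // IH mulgA.
have f_inv w : exists w', f w' = (f w)^-1%g.
  elim: w => [|s w [w' fw']]; first by exists [::]; rewrite /= invg1.
  exists (w' ++ [:: FSetSub (S_sym (valP s))]).
  by rewrite f_cat /= mulg1 fw' invgM.
have : range f = [set: Gamma].
  apply/seteqP; split => // x _.
  suff /asboolP : x \in [pred x | `[< range f x >]] by [].
  apply: S_gen.
    split; first by apply/asboolP; exists [::].
    move=> y z /asboolP[w _ <-] /asboolP[w' _ <-].
    have [w'' <-] := f_inv w'.
    by apply/asboolP; exists (w ++ w''); rewrite ?f_cat.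
  move=> s sS; apply/asboolP; exists [:: FSetSub sS] => //.
  by rewrite /= mulg1.
move=> <-; apply: sub_countable (card_image_le f setT) _; exact: countableP.
Qed.

End countable_group.

Lemma countable_seq (T : Type) : countable [set: T] -> countable [set: seq T].
Proof.
move=> /countable_injP[f f_inj]; apply: (@countable_inj _ _ (map f)).
by apply: inj_map => x y; exact: (f_inj x y (mem_set I) (mem_set I)).
Qed.

Lemma countable_prod (T U : Type) : countable [set: T] -> countable [set: U] ->
  countable [set: T * U].
Proof.
move=> /countable_injP[f f_inj] /countable_injP[g g_inj].
apply: (@countable_inj _ _ (fun p => (f p.1, g p.2))) => -[x y] [x' y'] [].
by move=> /(f_inj _ _ (mem_set I) (mem_set I)) -> /(g_inj _ _ (mem_set I) (mem_set I)) ->.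
Qed.

Section labels.
Variables (R : realType).
Local Notation UI := (unit_interval R).

(** The endpoint [u = 1] falls into an extra cell [n.+1], so there are [n.+2] possible values. *)
Definition cell (n : nat) (u : UI) : nat :=
  Num.truncn (unit_interval_val u * n.+1%:R).

Lemma unit_interval_valP (u : UI) : 0 <= unit_interval_val u <= 1.
Proof.
have : val u \in `[0 : R, 1]%classic by case: u.
by rewrite inE /= in_itv.
Qed.

Lemma cell_interval n j : [set u : UI | cell n u = j] =
  @unit_interval_val R @^-1` `[j%:R / n.+1%:R, j.+1%:R / n.+1%:R[.
Proof.
apply/seteqP; split => u; rewrite /= in_itv /= ler_pdivrMr ?ltr_pdivlMr ?ltr0n //.
all: have /andP[u0 _] := unit_interval_valP u.
  by rewrite /cell => <-; apply: truncn_itv; rewrite mulr_ge0.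
exact: truncn_def.
Qed.

Lemma measurable_cell n j : measurable [set u : UI | cell n u = j].
Proof.
rewrite cell_interval; exists `[j%:R / n.+1%:R, j.+1%:R / n.+1%:R[%classic.
  exact: measurable_itv.
by rewrite setTI.
Qed.

Lemma lam_cell n j : lam [set u : UI | cell n u = j] <= n.+1%:R^-1.
Proof.
rewrite /lam /uniform_law cell_interval.
set I1 := `[_, _[%classic; have mI : measurable I1 by exact: measurable_itv.
have -> : @unit_interval_val R @` (@unit_interval_val R @^-1` I1) =
    I1 `&` `[0 : R, 1]%classic.
  apply/seteqP; split => [_ [u Iu <-]|x [Ix x01]].
    by split => //=; rewrite in_itv /=; exact: unit_interval_valP.
  by exists (exist _ x (mem_set x01)).
have mI01 : measurable (I1 `&` `[0 : R, 1]%classic) by apply: measurableI.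
have I1E : lebesgue_measure I1 = (n.+1%:R^-1)%:E :> \bar R.
  rewrite /I1 lebesgue_measure_itv /= lte_fin ltr_pM2r ?invr_gt0 ?ltr0n //.
  by rewrite ltr_nat leqnn -EFinB -mulrBl -natrB // subSnn mul1r.
have le1 : (lebesgue_measure (I1 `&` `[0%R : R, 1%R]%classic) <= (n.+1%:R^-1)%:E)%E.
  by rewrite -I1E; apply: le_measure => //; rewrite inE.
rewrite -lee_fin fineK // ge0_fin_numE ?measure_ge0 //.
exact: le_lt_trans le1 (ltry _).
Qed.

(** Labels sharing a cell differ by less than [1 / n.+1]. Separation for all large [n] lets finitely
    many pairs be separated at once. *)
Lemma cell_separates (u v : UI) : u <> v ->
  exists n0, forall n, (n0 <= n)%N -> cell n u <> cell n v.
Proof.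
move=> uv; wlog lt_uv : u v uv / unit_interval_val u < unit_interval_val v.
  move=> wlog_hyp; have [lt|lt|e] := ltgtP (unit_interval_val u) (unit_interval_val v).
  - exact: wlog_hyp.
  - have [||n0 h] := wlog_hyp v u => //; first by move=> e; apply: uv.
    by exists n0 => n /h ne e; apply: ne.
  - by case: uv; apply: val_inj.
set a := unit_interval_val u in lt_uv *; set b := unit_interval_val v in lt_uv *.
have ab : 0 < b - a by rewrite subr_gt0.
exists (Num.truncn (b - a)^-1).+1 => n nn.
rewrite /cell -/a -/b => e.
have /andP[a0 _] := unit_interval_valP u; have /andP[b0 _] := unit_interval_valP v.
have n0 : (0 : R) <= n.+1%:R by [].
have /andP[h1 h2] := truncn_itv (mulr_ge0 a0 n0).
have /andP[h3 h4] := truncn_itv (mulr_ge0 b0 n0).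
have h5 : (b - a) * n.+1%:R < 1.
  by move: h1 h4; rewrite -/a -/b e -natr1 mulrBl; lra.
have h6 : (b - a)^-1 < n.+1%:R.
  apply: lt_le_trans (truncnS_gt _) _; rewrite ler_nat; exact: leqW nn.
by rewrite -ltr_pdivlMl // mulr1 in h5; rewrite ltNge (ltW h6) in h5.
Qed.

End labels.

(** * Matchings and augmenting paths *)

Section augmenting_paths.
Local Open Scope nat_scope.
Variables (V : choiceType) (G : V -> V -> Prop).
Hypothesis G_sym : forall x y, G x y -> G y x.
Implicit Types (f : V -> V) (x y a b : V) (p : V * V) (q : seq (V * V)).

(* A matching is encoded by the involution that swaps the two ends of its edges
   and fixes the unmatched vertices. *)
Definition matching f := involutive f /\ forall x, f x <> x -> G x (f x).

(* An alternating path a_0 b_0 a_1 b_1 ... is encoded by the list of its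
   unmatched edges (a_i, b_i), with [f b_i = a_(i+1)]. *)
Fixpoint links f b q : Prop :=
  match q with
  | [::] => f b = b
  | p :: q' => [/\ f b = p.1, G p.1 p.2 & links f p.2 q']
  end.

Definition augmenting f q : Prop :=
  match q with
  | [::] => False
  | p :: q' => [/\ f p.1 = p.1, G p.1 p.2 & links f p.2 q']
  end.

Definition verts q := unzip1 q ++ unzip2 q.

Lemma mem_verts_cons p q x :
  (x \in verts (p :: q)) = [|| x == p.1, x == p.2 | x \in verts q].
Proof.
by rewrite /verts /= inE !mem_cat inE; case: (x == p.1) => //=; rewrite orbCA.
Qed.

Lemma mem_cons_verts_cons b p q x : (x \in b :: verts (p :: q)) =
  [|| x == b, x == p.1, x == p.2 | x \in verts q].
Proof. by rewrite in_cons mem_verts_cons. Qed.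

Lemma links_suffix f b q1 p q2 : links f b (q1 ++ p :: q2) ->
  G p.1 p.2 /\ links f p.2 q2.
Proof. by elim: q1 b => [b [_ ? ?]|r q1 IH b [_ _ /IH]]. Qed.

Lemma links_replace f b q1 p q2 r q3 : links f b (q1 ++ p :: q2) ->
  r.1 = p.1 -> G r.1 r.2 -> links f r.2 q3 -> links f b (q1 ++ r :: q3).
Proof.
move=> + rp Gr lr; elim: q1 b => [b [fb _ _]|s q1 IH b [fb Gs /IH ls]] /=.
  by rewrite rp; split => //; rewrite -rp.
by [].
Qed.

Lemma augmenting_suffix f q1 p q2 : augmenting f (q1 ++ p :: q2) ->
  G p.1 p.2 /\ links f p.2 q2.
Proof. by case: q1 => [[_ ? ?]|r q1 [_ _ /links_suffix]]. Qed.

Lemma augmenting_replace f q1 p q2 r q3 : augmenting f (q1 ++ p :: q2) ->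
  r.1 = p.1 -> G r.1 r.2 -> links f r.2 q3 -> augmenting f (q1 ++ r :: q3).
Proof.
case: q1 => [[fp _ _] rp Gr lr|s q1 [fs Gs ls] rp Gr lr] /=.
  by rewrite -[X in f X = X]rp in fp.
by split => //; apply: links_replace ls _ _ _.
Qed.

Lemma augmenting_edge f q p : augmenting f q -> p \in q -> G p.1 p.2.
Proof. by move=> aq /(splitPr) h; case: h aq => q1 q2 /augmenting_suffix[]. Qed.

Lemma not_uniq_map_split (T : eqType) (g : V * V -> T) q : ~~ uniq (map g q) ->
  exists q1 p q2 r q3, q = q1 ++ p :: q2 ++ r :: q3 /\ g p = g r.
Proof.
elim: q => // p q IH /=; rewrite negb_and negbK => /orP[/mapP[r rq gpr]|/IH].
  case: (splitPr rq) => q2 q3; by exists [::], p, q2, r, q3.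
by move=> [q1 [p' [q2 [r [q3 [-> ?]]]]]]; exists (p :: q1), p', q2, r, q3.
Qed.

(** Colours alternate along the walk as long as each matching step really moves. A step with
    [f b = b] means that the walk could have stopped at [b], which gives the shorter list. *)
Lemma links_color f (c : V -> bool) b q :
  (forall x y, G x y -> c x != c y) -> matching f -> links f b q ->
  (forall p, p \in q -> c p.1 != c b /\ c p.2 = c b) \/
  exists2 q', links f b q' & (size q' < size q)%N.
Proof.
move=> cG [_ fG]; elim: q b => [b _|p q IH b /= [fb Gp lp]]; first by left.
have [fbb|/eqP fbb] := eqVneq (f b) b; first by right; exists [::].
have := cG _ _ (fG _ fbb); rewrite fb => cbp; have cp := cG _ _ Gp.
have cpb : c p.2 = c b by move: cbp cp; case: (c b) (c p.1) (c p.2) => [] [] [].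
case: (IH _ lp) => [colored|[q' lq' sq']].
  left=> r; rewrite inE => /orP[/eqP ->|/colored].
    by rewrite cpb eq_sym.
  by rewrite cpb.
by right; exists (p :: q').
Qed.

(** A repetition among the [a_i], or among the [b_i], closes a loop that can be cut out without
    disturbing the alternation. No [a_i] equals a [b_j], since the two families have opposite
    colours; this is where bipartiteness excludes odd cycles. *)
Lemma augmenting_uniq f (c : V -> bool) q :
  (forall x y, G x y -> c x != c y) -> matching f -> augmenting f q ->
  exists q', [/\ augmenting f q', uniq (verts q') & (size q' <= size q)%N].
Proof.
move=> cG mf; have [n] := ubnP (size q); elim: n q => // n IH q sq aq.
suff [[q' aq' sq']|//] : (exists2 q', augmenting f q' & (size q' < size q)%N) \/
    exists q', [/\ augmenting f q', uniq (verts q') & (size q' <= size q)%N].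
  have [|q'' [? ? sq'']] := IH q' _ aq'; first exact: leq_trans sq' _.
  by exists q''; split => //; exact: leq_trans sq'' (ltnW sq').
have [u1|] := boolP (uniq (unzip1 q)); last first.
  move=> /not_uniq_map_split[q1 [p [q2 [r [q3 [qE pr]]]]]]; left.
  rewrite qE in aq *; exists (q1 ++ r :: q3).
    have := aq; rewrite -cat_cons catA => /augmenting_suffix[Gr lr].
    exact: augmenting_replace aq (esym pr) Gr lr.
  by rewrite !size_cat /= !size_cat /=; lia.
have [u2|] := boolP (uniq (unzip2 q)); last first.
  move=> /not_uniq_map_split[q1 [p [q2 [r [q3 [qE pr]]]]]]; left.
  rewrite qE in aq *; exists (q1 ++ p :: q3).
    have [Gp _] := augmenting_suffix aq.
    have := aq; rewrite -cat_cons catA => /augmenting_suffix[_ lr].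
    by apply: (augmenting_replace aq erefl Gp); rewrite pr.
  by rewrite !size_cat /= !size_cat /=; lia.
case: q aq sq u1 u2 => // p q [fp Gp lp] sq u1 u2.
have cp := cG _ _ Gp.
case: (links_color cG mf lp) => [colored|[q' lq' sq']]; last first.
  by left; exists (p :: q').
have colored' r : r \in p :: q -> c r.1 = c p.1 /\ c r.2 = c p.2.
  rewrite inE => /orP[/eqP -> //|/colored[c1 c2]]; split => //.
  by move: cp c1 c2; case: (c p.1) (c p.2) (c r.1) => [] [] [].
right; exists (p :: q); split => //; rewrite /verts cat_uniq u1 u2 andbT.
apply/hasPn => x /mapP[r rq xr]; apply/negP => /mapP[r' r'q xr'].
have [_ cr] := colored' _ rq; have [cr' _] := colored' _ r'q.
by rewrite -cr -xr xr' cr' eqxx in cp.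
Qed.

Lemma links_closed f b q : involutive f -> links f b q ->
  forall x, x \in b :: verts q -> f x \in b :: verts q.
Proof.
move=> fK; elim: q b => [b /= fb x|p q IH b /= [fb _ lp] x].
  by rewrite !inE => /eqP ->; rewrite fb.
rewrite !mem_cons_verts_cons.
move=> /or4P[/eqP ->|/eqP ->|xp|xq]; first by rewrite fb eqxx orbT.
- by rewrite -fb fK eqxx.
- have := IH _ lp x; rewrite !inE xp => /(_ isT) /orP[->|->]; by rewrite ?orbT.
- have := IH _ lp x; rewrite !inE xq orbT => /(_ isT) /orP[->|->]; by rewrite ?orbT.
Qed.

(** Consequently the vertices off the path are matched among themselves, and a flip does not break
    their edges. *)
Lemma augmenting_closed f q : involutive f -> augmenting f q ->
  forall x, x \in verts q -> f x \in verts q.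
Proof.
move=> fK; case: q => // p q [fp _ lp] x; rewrite !mem_verts_cons => /orP[/eqP ->|xq].
  by rewrite fp eqxx.
by have := links_closed fK lp xq; rewrite inE => ->; rewrite orbT.
Qed.

(* The vertices reached from an unmatched vertex by an alternating walk with
   [2 k] edges, respectively [2 k + 1] edges for [inner]. *)
Fixpoint outer f k x : Prop :=
  match k with
  | 0 => f x = x
  | k'.+1 => exists2 y, outer f k' y & G y (f x)
  end.

Definition inner f k x := exists2 y, outer f k y & G y x.

(** The odd walk to [x] is continued along the even walk to [x] run backwards. As [x] is inner,
    [f x] is outer, so the neighbour of [f x] on the second walk is inner; two edges have passed
    from one walk to the other, and this repeats until an unmatched vertex is reached. *)
Lemma inner_outer f j k x : matching f -> inner f j x -> outer f k x ->
  exists2 u, inner f (j + k) u & f u = u.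
Proof.
move=> [fK _]; elim: k j x => [j x ix /= ox|k IH j x ix [z oz Gz]].
  by exists x; rewrite ?addn0.
rewrite addnS -addSn; apply: IH oz; exists (f x) => /=; last exact: G_sym.
by case: ix => y oy Gy; exists y; rewrite ?fK.
Qed.

Lemma inner_augmenting f j u : matching f -> inner f j u -> f u = u ->
  exists2 q, augmenting f q & size q = j.+1.
Proof.
move=> [fK _] [y oy Gy] fu.
(* The path is built from its end; [r] is the part already built, starting after [b]. *)
suff key : forall (r : seq (V * V)) y b, outer f j y -> G y b -> links f b r ->
    exists2 q, augmenting f q & size q = (j + size r).+1.
  by have := key [::] y u oy Gy fu; rewrite addn0.
elim: j {y u oy Gy fu} => [r y b oy Gy lr|j IH r y b [z oz Gz] Gy lr].
  by exists ((y, b) :: r).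
have [] := IH ((y, b) :: r) z (f y) oz Gz; first by rewrite /= fK.
by move=> q aq; rewrite addnS -addSn; exists q.
Qed.

Lemma links_ext f f' b q : {in b :: verts q, f =1 f'} -> links f b q -> links f' b q.
Proof.
elim: q b => [b ff' /= fb|p q IH b ff' /= [fb Gp lp]].
  by rewrite -ff' ?mem_head.
split => //; first by rewrite -ff' ?mem_head.
apply: IH lp => x xq; apply: ff'; rewrite mem_cons_verts_cons.
by move: xq; rewrite inE => /orP[->|->]; rewrite ?orbT.
Qed.

Lemma augmenting_ext f f' q : {in verts q, f =1 f'} ->
  augmenting f q -> augmenting f' q.
Proof.
case: q => // p q ff' [fp Gp lp]; split => //.
  by rewrite -ff' // mem_verts_cons eqxx.
apply: links_ext lp => x xq; apply: ff'; rewrite mem_verts_cons.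
by move: xq; rewrite inE => /orP[->|->]; rewrite ?orbT.
Qed.

Section flip.
Variables (f : V -> V) (Fl : seq (V * V) -> Prop).
Hypothesis mf : matching f.
Hypothesis Fl_aug : forall q, Fl q -> augmenting f q /\ uniq (verts q).
Hypothesis Fl_disj : forall q q' x,
  Fl q -> Fl q' -> x \in verts q -> x \in verts q' -> q = q'.

(** The pairs listed in a path are its unmatched edges, precisely those that enter the matching when
    the path is flipped. *)
Definition partner x y :=
  exists2 q, Fl q & ((x, y) \in q) || ((y, x) \in q).

Definition flip x := xget (f x) [set y | partner x y].

Lemma partner_verts q x y : ((x, y) \in q) || ((y, x) \in q) ->
  x \in verts q.
Proof.
rewrite /verts mem_cat => /orP[] h; apply/orP; [left|right].
  exact: (map_f fst h).
exact: (map_f snd h).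
Qed.

Lemma partner_sym x y : partner x y -> partner y x.
Proof. by move=> [q Fq xy]; exists q => //; rewrite orbC. Qed.

Lemma uniq_map_inj (T : eqType) (g : V * V -> T) q p p' : uniq (map g q) ->
  p \in q -> p' \in q -> g p = g p' -> p = p'.
Proof.
elim: q => // r q IH /= /andP[rq uq]; rewrite !inE.
move=> /orP[/eqP ->|pq] /orP[/eqP ->|p'q] // gpp.
- by rewrite gpp map_f in rq.
- by rewrite -gpp map_f in rq.
- exact: IH.
Qed.

Lemma partner_fun x y y' : partner x y -> partner x y' -> y = y'.
Proof.
move=> [q Fq xy] [q' Fq' xy'].
have qq' := Fl_disj Fq Fq' (partner_verts xy) (partner_verts xy').
subst q'; have [_] := Fl_aug Fq; rewrite /verts cat_uniq => /and3P[u1 u12 u2].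
have disj z t t' : (z, t) \in q -> (t', z) \in q -> False.
  move=> /(map_f fst) /= h1 /(map_f snd) /= h2.
  by move/hasPn: u12 => /(_ _ h2); rewrite h1.
case/orP: xy => h; case/orP: xy' => h'.
- by have [] := uniq_map_inj u1 h h' erefl.
- by case: (disj _ _ _ h h').
- by case: (disj _ _ _ h' h).
- by have [] := uniq_map_inj u2 h h' erefl.
Qed.

Lemma flip_partner x y : partner x y -> flip x = y.
Proof.
move=> xy; apply: (partner_fun _ xy); rewrite /flip.
by apply: (@xgetPex _ (f x) [set y | partner x y]); exists y.
Qed.

Lemma flip_id x : (forall q, Fl q -> x \notin verts q) -> flip x = f x.
Proof.
by move=> nx; apply: xgetPN => y [q /nx /negP xq /partner_verts].
Qed.

Lemma verts_partner q x : Fl q -> x \in verts q ->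
  exists2 y, partner x y & y \in verts q.
Proof.
move=> Fq; rewrite /verts mem_cat => /orP[] /mapP[[a b] abq /= ->].
  exists b; first by exists q; rewrite ?abq.
  by rewrite mem_cat (map_f snd abq) orbT.
exists a; first by exists q; rewrite ?abq ?orbT.
by rewrite mem_cat (map_f fst abq).
Qed.

Lemma flipP x : (exists2 q, Fl q & x \in verts q /\ partner x (flip x)) \/
  ((forall q, Fl q -> x \notin verts q) /\ flip x = f x).
Proof.
have [[q Fq xq]|nq] := pselect (exists2 q, Fl q & x \in verts q).
  left; exists q => //; split => //.
  by have [y xy _] := verts_partner Fq xq; rewrite (flip_partner xy).
have nx q : Fl q -> x \notin verts q by move=> Fq; apply/negP => xq; apply: nq; exists q.
by right; split => //; exact: flip_id.
Qed.

Lemma flip_matching : matching flip.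
Proof.
split=> x; have [[q Fq [xq xfx]]|[nx fx]] := flipP x.
- exact: flip_partner (partner_sym xfx).
- rewrite fx flip_id ?mf.1 // => q Fq; apply/negP => fxq.
  have [aq _] := Fl_aug Fq; have := augmenting_closed mf.1 aq fxq.
  by rewrite mf.1; apply/negP; exact: nx.
- move=> _; case: xfx => r /Fl_aug[ar _] /orP[] h; first exact: augmenting_edge ar h.
  exact/G_sym/(augmenting_edge ar h).
- by rewrite fx => /mf.2.
Qed.

Lemma flip_fix x : flip x = x -> f x = x.
Proof.
have [[q Fq [xq xfx]]|[nx -> //]] := flipP x.
move=> fxx; rewrite fxx in xfx; case: xfx => r /Fl_aug[_ +] xxr.
have xr : (x, x) \in r by move: xxr; rewrite orbb.
rewrite /verts cat_uniq => /and3P[_ /hasPn h _].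
by have := h _ (map_f snd xr); rewrite (map_f fst xr).
Qed.

(** This is the gain of a flip: it lets [position_bound] charge each path to a newly matched vertex,
    and it contradicts stability in [ae_stage]. *)
Lemma flip_head p q : Fl (p :: q) -> f p.1 = p.1 /\ flip p.1 <> p.1.
Proof.
move=> Fq; have [[fp _ _] uq] := Fl_aug Fq; split => //.
rewrite (@flip_partner _ p.2); last first.
  by exists (p :: q) => //; rewrite -surjective_pairing mem_head.
move=> pp; move: uq; rewrite /verts cat_uniq /= => /and3P[_ + _].
by rewrite -pp; rewrite mem_head.
Qed.

End flip.

Fixpoint near n x y : Prop :=
  match n with
  | 0 => x = y
  | n'.+1 => exists2 z, x = z \/ G x z & near n' z y
  end.

Lemma near_refl n x : near n x x.
Proof. by elim: n => //= n IH; exists x; first left. Qed.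

Lemma near_trans n m x y z : near n x y -> near m y z -> near (n + m) x z.
Proof.
elim: n x => [x /= -> //|n IH x /= [t xt ty] yz]; exists t => //; exact: IH.
Qed.

Lemma near_sym n x y : near n x y -> near n y x.
Proof.
elim: n x y => [x y /= -> //|n IH x y [z xz /IH zy]].
rewrite -addn1; apply: (near_trans zy).
by exists x => //; case: xz => [->|/G_sym]; [left|right].
Qed.

Lemma links_near f b q : (forall x, f x <> x -> G x (f x)) -> links f b q ->
  forall x, x \in b :: verts q -> near (2 * size q) b x.
Proof.
move=> fG; elim: q b => [b _ x|p q IH b [fb Gp lp] x].
  by rewrite inE => /eqP ->.
have step : b = p.1 \/ G b p.1.
  have [bb|/eqP bb] := eqVneq (f b) b; first by left; rewrite -bb.
  by right; rewrite -fb; exact: fG.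
rewrite (_ : 2 * size (p :: q) = (2 * size q).+2)%N; last by rewrite /=; lia.
rewrite mem_cons_verts_cons => /or4P[/eqP ->|/eqP ->|xp|xq].
- exact: (near_refl (2 * size q).+2).
- exists p.1; [exact: step|exact: (near_refl (2 * size q).+1)].
- exists p.1 => //; exists p.2; [by right|].
  by apply: IH => //; rewrite inE xp.
- exists p.1 => //; exists p.2; [by right|].
  by apply: IH => //; rewrite inE xq orbT.
Qed.

(** All vertices of the path are within [2 * size q] of its first vertex, and two of them are
    compared through it. This confines the competitors of a path to a finite region. *)
Lemma augmenting_near f q x y : (forall x, f x <> x -> G x (f x)) ->
  augmenting f q -> x \in verts q -> y \in verts q ->
  near (2 * size q + 2 * size q) x y.
Proof.
move=> fG aq; suff [h hq] : exists h, forall x, x \in verts q -> near (2 * size q) h x.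
  by move=> /hq /near_sym xh /hq hy; exact: near_trans hy.
case: q aq => // p q [fp Gp lp]; exists p.1 => z; rewrite mem_verts_cons.
rewrite (_ : 2 * size (p :: q) = (2 * size q).+2)%N; last by rewrite /=; lia.
move=> /or3P[/eqP ->|zp|zq]; first exact: (near_refl (2 * size q).+2).
- exists p.2; first by right.
  exists p.2; first by left.
  by apply: links_near lp _ _ => //; rewrite inE zp.
- exists p.2; first by right.
  exists p.2; first by left.
  by apply: links_near lp _ _ => //; rewrite inE zq orbT.
Qed.

End augmenting_paths.

(** * Mass transport *)

Section mass_transport.
Variables (R : realType) (Gamma : groupType).
Local Notation UI := (unit_interval R).
Local Notation Omega := (product_space Gamma UI).
Variable mu : probability Omega R.
Hypothesis mu_product : is_lebesgue_product mu.
Hypothesis Gamma_countable : countable [set: Gamma].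

(** By invariance [Q 1 y] and [Q y^-1 1] are equally likely. Summed over [y], the first
    probabilities bound that of the union, while the second belong to disjoint events, since the
    receiver [1] has at most one sender. *)
Lemma mass_transport (Q : Omega -> Gamma -> Gamma -> Prop) :
  (forall x y, mpred (fun omega => Q omega x y)) ->
  (forall s omega x y, Q (tau s omega) x y <-> Q omega (x * s)%g (y * s)%g) ->
  (forall omega x x' y, Q omega x y -> Q omega x' y -> x = x') ->
  Pr mu [set omega | exists y, Q omega 1%g y] <=
  Pr mu [set omega | exists x, Q omega x 1%g].
Proof.
move=> mQ Qtau Qinj; have /countable_injP[iota iota_inj] := Gamma_countable.
have inj x y : iota x = iota y -> x = y by exact: (iota_inj _ _ (mem_set I) (mem_set I)).
pose E n := [set omega | exists2 y, iota y = n & Q omega 1%g y].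
pose E' n := [set omega | exists2 y, iota y = n & Q omega y^-1%g 1%g].
have mE n : measurable (E n).
  by apply: (mpred_ex2 Gamma_countable) => // y; exact: mpred_cst.
have mE' n : measurable (E' n).
  by apply: (mpred_ex2 Gamma_countable) => // y; exact: mpred_cst.
have EE' n : mu (E n) = mu (E' n).
  have [[y yn]|no] := pselect (exists y, iota y = n); last first.
    by congr (mu _); apply/seteqP; split=> omega [y yn]; case: no; exists y.
  rewrite -(mu_tau mu_product y (mE' n)); congr (mu _); apply/seteqP.
  split=> omega [z zn /=]; rewrite -yn in zn; move/inj: zn => -> Qz.
    by exists y => //; apply/Qtau; rewrite mulVg mul1g.
  by exists y => //; move/Qtau: Qz; rewrite mulVg mul1g.
rewrite -lee_fin !EFin_Pr; try exact: mpred_ex.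
apply: (@le_trans _ _ (\sum_(n <oo) mu (E n))%E).
  apply: measure_sigma_subadditive => //; first exact: mpred_ex.
  by move=> omega [y Qy]; exists (iota y) => //; exists y.
rewrite (eq_eseriesr (fun n _ => EE' n)).
have tE' : trivIset setT E'.
  move=> i j _ _ [omega [[y <- Qy] [z <- Qz]]].
  by have /invg_inj -> := Qinj _ _ _ _ Qy Qz.
have <- : mu (\bigcup_n E' n) = (\sum_(n <oo) mu (E' n))%E.
  rewrite (measure_bigcup mu setT E' (fun i _ => mE' i) tE').
  by apply: eq_eseriesl => i; rewrite in_setT.
apply: le_measure; rewrite ?inE //=.
- by apply: bigcup_measurable => n _.
- exact: mpred_ex.
by move=> omega [n _ [y _ Qy]]; exists y^-1%g.
Qed.

Lemma mpred_cell n j x : mpred (fun omega : Omega => cell n (omega x) = j).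
Proof. exact: (measurable_coord x (measurable_cell R n j)). Qed.

Lemma labels_distinct x y : x <> y ->
  mu [set omega : Omega | omega x = omega y] = 0.
Proof.
move=> xy.
pose A n := [set omega : Omega | cell n (omega x) = cell n (omega y)].
have mA n : measurable (A n).
  apply: (@eq_mpred _ _ (fun omega : Omega => exists2 j,
    cell n (omega x) = j & cell n (omega y) = j)).
    by move=> omega; split=> [[j -> ->]|]; last by exists (cell n (omega y)).
  by apply: mpred_ex2 => // j; exact: mpred_cell.
have capA : [set omega : Omega | omega x = omega y] = \bigcap_n A n.
  apply/seteqP; split=> omega /=; first by rewrite /A /= => e n _ /=; rewrite e.
  move=> eA; apply: contrapT => /cell_separates[n0 /(_ n0 (leqnn _))]; apply.
  exact: eA.
(* Two independent labels share a given cell with probability at most [1 / (n + 1)^2], and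
   [(n + 2) / (n + 1)^2 <= 2 / (n + 1)]. *)
have PrA n : Pr mu (A n) <= 2 / n.+1%:R.
  have n0 : 0 < n.+1%:R :> R by [].
  pose B j := rect [fset x; y]%fset (fun=> [set u : UI | cell n u = j]).
  have mB j : measurable (B j) by apply: measurable_rect => _; exact: measurable_cell.
  have PrB j : Pr mu (B j) <= n.+1%:R^-1 ^+ 2.
    rewrite Pr_rect; [|exact: mu_product|by move=> _; exact: measurable_cell].
    have lam0 : 0 <= lam [set u : UI | cell n u = j] by rewrite fine_ge0 // measure_ge0.
    rewrite big_fsetU1 ?inE /=; last exact/eqP.
    by rewrite big_seq_fset1 -expr2 ler_sqr ?nnegrE ?invr_ge0 // lam_cell.
  apply: (@le_trans _ _ (\sum_(j < n.+2) Pr mu (B j))).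
    rewrite -Ex_indic //; under eq_bigr do rewrite -Ex_indic //.
    rewrite -Ex_sum; last by move=> j; exact: bm_indic.
    apply: le_Ex; [exact: bm_indic|by apply: bm_sum => j; exact: bm_indic|].
    move=> omega; have [Aw|nAw] := pselect (A n omega); last first.
      by rewrite indicE memNset // sumr_ge0.
    have jn : (cell n (omega x) < n.+2)%N.
      rewrite ltnS -(ler_nat R).
      have /andP[u0 u1] := unit_interval_valP (omega x).
      have [] := truncn_itv (mulr_ge0 u0 (ltW n0)) => /andP[+ _] => h.
      by apply: (le_trans h); rewrite ler_piMl // ltW.
    rewrite (bigD1 (Ordinal jn)) //= indicE mem_set // indicE mem_set /=.
      by rewrite lerDl sumr_ge0.
    by move=> z; rewrite !inE => /orP[] /eqP -> //=; rewrite -Aw.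
  apply: (@le_trans _ _ (\sum_(j < n.+2) n.+1%:R^-1 ^+ 2)); first exact: ler_sum.
  rewrite sumr_const card_ord -[X in X <= _]mulr_natl expr2 mulrA.
  rewrite ler_pM2r ?invr_gt0 // ler_pdivrMr // -natrM ler_nat; lia.
have mcap : measurable (\bigcap_n A n) by exact: bigcapT_measurable.
rewrite capA -EFin_Pr //; congr (_%:E); apply/eqP.
rewrite eq_le Pr_ge0 andbT; apply/ler_addgt0Pr => e e0; rewrite add0r.
pose n := Num.truncn (2 / e).
have h : 2 / n.+1%:R <= e.
  have := truncnS_gt (2 / e); rewrite -/n ltr_pdivrMr // => h.
  by rewrite ler_pdivrMr // mulrC ltW.
apply: le_trans (le_trans (PrA n) h); apply: Pr_le => //; exact: bigcap_inf.
Qed.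

Lemma ae_imply (P Q : Omega -> Prop) : (forall omega, P omega -> Q omega) ->
  (\forall omega \ae mu, P omega) -> \forall omega \ae mu, Q omega.
Proof. by move=> PQ; apply: negligibleS => omega /= nQ /PQ. Qed.

Lemma ae_all_countable (U : Type) (P : U -> Omega -> Prop) :
  countable [set: U] -> (forall u, \forall omega \ae mu, P u omega) ->
  \forall omega \ae mu, forall u, P u omega.
Proof.
move=> /countable_injP[iota iota_inj] aeP.
have inj x y : iota x = iota y -> x = y by exact: (iota_inj _ _ (mem_set I) (mem_set I)).
suff : \forall omega \ae mu, forall n u, iota u = n -> P u omega.
  by apply: ae_imply => omega h u; exact: (h (iota u)).
suff neg : mu.-negligible (\bigcup_n [set omega | ~ forall u, iota u = n -> P u omega]).
  by apply: negligibleS neg => omega /= /existsNP[n nP]; exists n.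
apply: negligible_bigcup => n.
have [[u un]|no] := pselect (exists u, iota u = n).
  apply: negligibleS (aeP u) => omega /= nP Pu; apply: nP => v.
  by rewrite -un => /inj ->.
apply: negligibleS (negligible_set0 _) => omega /= []; move=> u un.
by case: no; exists u.
Qed.

Lemma ae_labels_distinct : \forall omega \ae mu, forall x y : Gamma,
  x <> y -> omega x <> omega y.
Proof.
have : \forall omega \ae mu, forall p : Gamma * Gamma, p.1 <> p.2 ->
    omega p.1 <> omega p.2.
  apply: ae_all_countable => [|p]; first exact: countable_prod.
  have [->|/eqP pp] := eqVneq p.1 p.2; first by apply: aeW.
  exists [set omega : Omega | omega p.1 = omega p.2]; split.
  - apply: (@eq_mpred _ _ (fun omega : Omega => forall n,
      exists2 j, cell n (omega p.1) = j & cell n (omega p.2) = j)).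
      move=> omega; split=> [h|-> n]; last by exists (cell n (omega p.2)).
      apply: contrapT => /cell_separates[n0 /(_ n0 (leqnn _))]; apply.
      by have [j -> ->] := h n0.
    apply: mpred_all => // n; apply: mpred_ex2 => // j; exact: mpred_cell.
  - exact: labels_distinct.
  - move=> omega /= h; apply: contrapT => ne; apply: h => _ e; exact: ne.
by apply: ae_imply => omega h x y; exact: (h (x, y)).
Qed.

End mass_transport.

(** * Density of unmatched vertices *)

Section factor_matchings.
Variables (R : realType) (Gamma : groupType) (S : {fset Gamma}).
Local Notation UI := (unit_interval R).
Local Notation Omega := (product_space Gamma UI).
Local Notation G := (cayley S).
Hypothesis Gamma_countable : countable [set: Gamma].

Record factor_matching (m : Omega -> Gamma -> Gamma) : Prop := FactorMatching {
  fm_matching : forall omega, matching G (m omega);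
  fm_equiv : forall (g : graph_aut G) omega x,
    m (act_vertex g omega) (g x) = g (m omega x);
  fm_measurable : forall x y, mpred (fun omega => m omega x = y) }.

Lemma cayley_mulr s x y : G (x * s)%g (y * s)%g <-> G x y.
Proof.
split=> -[t tS e]; exists t => //; last by rewrite e mulgA.
by apply: (mulIg s); rewrite e mulgA.
Qed.

Definition right_aut (s : Gamma) : graph_aut G :=
  GraphAut (aut_fun := fun x => (x * s^-1)%g) (aut_inv := fun x => (x * s)%g)
    (mulgVK s) (mulgK s) (fun x y => cayley_mulr s^-1%g x y).

Variable m : Omega -> Gamma -> Gamma.
Hypothesis fm : factor_matching m.

Lemma fm_tau s omega x : m (tau s omega) x = (m omega (x * s) * s^-1)%g.
Proof.
have := fm_equiv fm (right_aut s) omega (x * s)%g.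
by rewrite /= mulgK.
Qed.

Lemma outer_tau k s omega x :
  outer G (m (tau s omega)) k x <-> outer G (m omega) k (x * s)%g.
Proof.
elim: k x => [x|k IH x] /=; rewrite fm_tau.
  split=> [e|->]; last by rewrite mulgK.
  by rewrite -[X in _ = (X * _)%g]e mulgVK.
split=> [[y /IH oy Gy]|[y oy Gy]].
  exists (y * s)%g => //; apply/(cayley_mulr s^-1%g).
  by rewrite mulgK.
exists (y * s^-1)%g; first by apply/IH; rewrite mulgVK.
exact/cayley_mulr.
Qed.

Lemma inner_tau k s omega x :
  inner G (m (tau s omega)) k x <-> inner G (m omega) k (x * s)%g.
Proof.
split=> [[y /outer_tau oy Gy]|[y oy Gy]].
  by exists (y * s)%g => //; apply/cayley_mulr.
exists (y * s^-1)%g; first by apply/outer_tau; rewrite mulgVK.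
by apply/(cayley_mulr s); rewrite mulgVK.
Qed.

Lemma mpred_outer k x : mpred (fun omega => outer G (m omega) k x).
Proof.
elim: k x => [x|k IH x]; first exact: fm_measurable.
apply: mpred_ex2 => // y.
apply: (@eq_mpred _ _ (fun omega => exists2 z, m omega x = z & G y z)).
  by move=> omega; split=> [[z -> //]|]; exists (m omega x).
by apply: mpred_ex2 => // z; [exact: fm_measurable|exact: mpred_cst].
Qed.

Lemma mpred_inner k x : mpred (fun omega => inner G (m omega) k x).
Proof.
by apply: mpred_ex2 => // y; [exact: mpred_outer|exact: mpred_cst].
Qed.

Section density.
Variable mu : probability Omega R.
Hypothesis mu_product : is_lebesgue_product mu.
Hypothesis G_sym : forall x y, G x y -> G y x.
Variable color : Gamma -> bool.
Hypothesis bip : forall x y, G x y -> color x != color y.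
Variables (C : R).
Hypothesis C_ge0 : 0 <= C.
Hypothesis C_lt : C < #|` S|%:R.
Hypothesis gap : forall (h : Gamma -> R) (Y : {fset Gamma}),
    (forall x, x \notin Y -> h x = 0) -> (forall x, 0 <= h x) ->
    \sum_(x <- Y) \sum_(s <- S) h x * h (s * x)%g <=
    C * \sum_(x <- Y) h x ^+ 2.
Hypothesis S_neq0 : S != fset0.

Let w k := Pr mu [set omega | outer G (m omega) k 1%g].

(** The involution [m omega] exchanges the vertices of [inner k] and of [outer k.+1]. Mass sent
    along it gives one inequality in each direction. *)
Lemma Pr_inner k : Pr mu [set omega | inner G (m omega) k 1%g] = w k.+1.
Proof.
have fK omega := (fm_matching fm omega).1.
apply: le_anti; apply/andP; split.
  pose Q omega x y := inner G (m omega) k x /\ m omega x = y.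
  have := @mass_transport _ _ _ mu_product Gamma_countable Q.
  rewrite (_ : [set omega | exists y, Q omega _ y] =
      [set omega | inner G (m omega) k 1%g]); last first.
    by apply/seteqP; split=> omega; [case=> y []|exists (m omega 1%g)].
  move=> h; apply: (le_trans (h _ _ _)) => {h}.
  - by move=> x y; apply: mpred_and; [exact: mpred_inner|exact: fm_measurable].
  - move=> s omega x y; split=> [[/inner_tau ix <-]|[ix xy]].
      by split=> //; rewrite fm_tau mulgVK.
    by split; [exact/inner_tau|rewrite fm_tau xy mulgK].
  - by move=> omega x x' y [_ <-] [_ /(can_inj (fK omega))].
  - apply: Pr_le; [|exact: mpred_outer|].
      apply: mpred_ex => // x; apply: mpred_and; [exact: mpred_inner|exact: fm_measurable].
    move=> omega [x [[z oz Gz] xy]] /=; exists z => //.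
    by rewrite -xy fK.
pose Q omega x y := m omega x = y /\ inner G (m omega) k y.
have := @mass_transport _ _ _ mu_product Gamma_countable Q.
rewrite (_ : [set omega | exists y, Q omega _ y] =
    [set omega | outer G (m omega) k.+1 1%g]); last first.
  by apply/seteqP; split=> omega; [case=> y [<-]|exists (m omega 1%g)].
move=> h; apply: (le_trans (h _ _ _)) => {h}.
- by move=> x y; apply: mpred_and; [exact: fm_measurable|exact: mpred_inner].
- move=> s omega x y; split=> [[<- /inner_tau ix]|[xy ix]].
    by rewrite fm_tau mulgVK in ix *.
  by split; [rewrite fm_tau xy mulgK|exact/inner_tau].
- by move=> omega x x' y [<- _] [/(can_inj (fK omega))].
- apply: Pr_le; [|exact: mpred_inner|by move=> omega [x [_]]].
  apply: mpred_ex => // x; apply: mpred_and; [exact: fm_measurable|exact: mpred_inner].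
Qed.

(** One generator is enough: if [s] is outer then its neighbour [1] is inner, and translation does
    not change the probability of the former. *)
Lemma outer_le k : w k <= w k.+1.
Proof.
have [s sS] : exists s, s \in S by apply/fset0Pn.
rewrite -Pr_inner /w -(Pr_tau mu_product s (mpred_outer k 1%g)).
apply: Pr_le; [exact: measurable_tauP (mpred_outer k 1%g)|exact: mpred_inner|].
move=> omega /= /outer_tau; rewrite mul1g => os; exists s => //; apply: G_sym.
by exists s; rewrite ?mulg1.
Qed.

(** [expansion] is applied to the outer vertices and the complement of the inner ones. Divided by
    [(1 - w k) * (1 - w k.+1)], the conclusion compares the odds of [w k] and [w k.+1], with the
    factor called [rate] below. *)
Lemma outer_expand k : w k.+1 < 1 -> w k < 1 ->
  (#|` S|%:R *+ 2 - C) * (w k * (1 - w k.+1)) <= C * (w k.+1 * (1 - w k)).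
Proof.
move=> w'1 w1.
pose A := [set omega | ~ inner G (m omega) k 1%g].
pose B := [set omega | outer G (m omega) k 1%g].
have mA : measurable A by exact: mpred_not (mpred_inner _ _).
have mB : measurable B by exact: mpred_outer.
have PrA : Pr mu A = 1 - w k.+1.
  by rewrite -Pr_inner -PrC //; exact: mpred_inner.
have Gs s : s \in S -> G 1%g s by move=> sS; exists s; rewrite ?mulg1.
have AB s : s \in S -> A `&` tau s @^-1` B = set0.
  move=> sS; apply/seteqP; split=> // omega [/= ni /outer_tau]; rewrite mul1g => os.
  by apply: ni; exists s => //; exact/G_sym/Gs.
have BA s : s \in S -> B `&` tau s @^-1` A = set0.
  move=> sS; apply/seteqP; split=> // omega [/= o1]; apply; apply/inner_tau.
  by rewrite mul1g; exists 1%g => //; exact: Gs.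
have h : 2 * #|` S|%:R * ((1 - w k.+1) * w k) <=
  C * ((1 - w k.+1) * w k + (1 - (1 - w k.+1)) * (1 - w k)).
  have := expansion mu_product C_ge0 gap mA mB AB BA.
  by rewrite /= PrA -/(w k) => h; apply: h; rewrite // subr_gt0.
move: h; set d := #|` S|%:R; set a := w k.+1; set b := w k => h.
rewrite mulrBl -subr_ge0.
have -> : C * (a * (1 - b)) - (d *+ 2 * (b * (1 - a)) - C * (b * (1 - a))) =
   C * ((1 - a) * b + (1 - (1 - a)) * (1 - b)) - 2 * d * ((1 - a) * b).
  by rewrite -(mulr_natl d 2); ring.
by rewrite subr_ge0.
Qed.

Definition rate := C / (#|` S|%:R *+ 2 - C).

Lemma rate_itv : 0 <= rate < 1.
Proof.
have d2 : 0 < #|` S|%:R *+ 2 - C by have := C_lt; have := C_ge0; lra.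
rewrite /rate; apply/andP; split; first by apply: divr_ge0 => //; exact: ltW.
by rewrite ltr_pdivrMr // mul1r; move: C_lt; lra.
Qed.

Lemma unmatched_small n :
  (\forall omega \ae mu, forall q, augmenting G (m omega) q -> uniq (verts q) ->
    (2 * n + 1 < size q)%N) ->
  Pr mu [set omega | m omega 1%g = 1%g] <= rate ^+ n.
Proof.
move=> noaug.
(* A vertex both outer and inner at [k] would yield an augmenting path with at most [2 * k + 1]
   listed edges. *)
have disj k : (k <= n)%N -> w k + w k.+1 <= 1.
  move=> kn; rewrite -Pr_inner -lerBrDr -PrC; last exact: mpred_inner.
  have mI := measurableI _ _ (mpred_outer k 1%g) (mpred_inner k 1%g).
  have null : Pr mu ([set omega | outer G (m omega) k 1%g] `&`
      [set omega | inner G (m omega) k 1%g]) = 0.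
    rewrite /Pr measure_negligible //.
    apply: negligibleS noaug => omega [/= o1 i1] no.
    have mm := fm_matching fm omega.
    have [u iu fu] := inner_outer G_sym mm i1 o1.
    have [q aq sq] := inner_augmenting mm iu fu.
    have [q' [aq' uq' sq']] := augmenting_uniq bip mm aq.
    rewrite sq in sq'; have := leq_trans (no q' aq' uq') sq'.
    move: kn; clear; lia.
  have mO : measurable [set omega | outer G (m omega) k 1%g] by exact: mpred_outer.
  have mN : measurable (~` [set omega | inner G (m omega) k 1%g]).
    by apply: measurableC; exact: mpred_inner.
  rewrite /w -(Ex_indic mu mO) -(Ex_indic mu mN) -[leRHS]addr0 -null -(Ex_indic mu mI).
  rewrite -ExD; [|exact: bm_indic|exact: bm_indic].
  apply: le_Ex; [exact: bm_indic|by apply: bmD; exact: bm_indic|].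
  move=> omega /=; rewrite !indicE in_setI in_setC.
  by case: (omega \in _); case: (omega \in _) => /=; lra.
have wle k : (k <= n)%N -> w k <= 1 / 2.
  by move=> /disj; have := outer_le k; lra.
have /andP[r0 r1] := rate_itv.
have d2 : 0 < #|` S|%:R *+ 2 - C by have := C_lt; have := C_ge0; lra.
(* The induction goes down from index [n], where [w n <= 1 / 2] says that the odds are at most 1;
   each step towards 0 gains a factor [rate]. *)
have key j : (j <= n)%N -> w (n - j)%N <= rate ^+ j * (1 - w (n - j)%N).
  elim: j => [_|j IH jn].
    by rewrite subn0 expr0 mul1r; have := wle n (leqnn n); lra.
  have {}IH := IH (ltnW jn).
  have e : (n - j)%N = (n - j.+1).+1 by lia.
  rewrite e in IH; set k := (n - j.+1)%N in IH *.
  have k1 := wle k (leq_subr _ _).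
  have k2 : w k.+1 <= 1 / 2 by apply: wle; rewrite -e leq_subr.
  have h : w k * (1 - w k.+1) <= rate * (w k.+1 * (1 - w k)).
    have := @outer_expand k; rewrite /rate mulrAC ler_pdivlMr // mulrC.
    by apply; lra.
  have pos : 0 < 1 - w k.+1 by lra.
  rewrite -(ler_pM2r pos); apply: (le_trans h).
  have -> : rate ^+ j.+1 * (1 - w k) * (1 - w k.+1) =
      rate * ((rate ^+ j * (1 - w k.+1)) * (1 - w k)) by rewrite exprS; ring.
  by rewrite ler_wpM2l // ler_wpM2r //; lra.
have := key n (leqnn n); rewrite subnn => h.
apply: (le_trans h); rewrite ler_piMr ?exprn_ge0 // lerBlDr lerDl; exact: Pr_ge0.
Qed.

End density.

End factor_matchings.

(** * Equivariant flips *)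

Section flip_step.
Variables (R : realType) (Gamma : groupType) (S : {fset Gamma}).
Local Notation UI := (unit_interval R).
Local Notation Omega := (product_space Gamma UI).
Local Notation G := (cayley S).
Implicit Types (g : graph_aut G) (omega : Omega) (q : seq (Gamma * Gamma)).
Hypothesis Gamma_countable : countable [set: Gamma].
Hypothesis G_sym : forall x y, G x y -> G y x.

Definition gmap (h : Gamma -> Gamma) q := [seq (h p.1, h p.2) | p <- q].

Lemma verts_gmap h q : verts (gmap h q) = map h (verts q).
Proof. by rewrite /verts /unzip1 /unzip2 /gmap map_cat -!map_comp. Qed.

Lemma gmapK h h' : cancel h h' -> cancel (gmap h) (gmap h').
Proof.
by move=> hK; elim=> [//|[x y] q IH] /=; rewrite !hK IH.
Qed.

Lemma links_gmap g f f' b q : (forall x, f' (g x) = g (f x)) ->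
  links G f b q -> links G f' (g b) (gmap g q).
Proof.
move=> ff'; elim: q b => [b /= fb|p q IH b /= [fb Gp /IH lp]].
  by rewrite ff' fb.
by split => //; [rewrite ff' fb|apply/aut_adj].
Qed.

Lemma augmenting_gmap g f f' q : (forall x, f' (g x) = g (f x)) ->
  augmenting G f q -> augmenting G f' (gmap g q).
Proof.
move=> ff'; case: q => // p q [fp Gp lp] /=; split.
- by rewrite ff' fp.
- exact/aut_adj.
- exact: links_gmap lp.
Qed.

Lemma act_vertexK g omega : act_vertex (graph_autV g) (act_vertex g omega) = omega.
Proof. by apply/funext => x; rewrite /act_vertex /= aut_funK. Qed.

(* A colour [(n, l)] prescribes the cells of size [1 / n.+1] containing the
   labels along a path. Two augmenting paths of the same colour that meet are
   not flipped: which one to choose could not be decided equivariantly. *)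
Definition has_color (c : nat * seq (nat * nat)) omega q :=
  [seq (cell c.1 (omega p.1), cell c.1 (omega p.2)) | p <- q] = c.2.

Variables (m : Omega -> Gamma -> Gamma) (N : nat) (c : nat * seq (nat * nat)).
Hypothesis fm : factor_matching S m.

Definition candidate omega q := [/\ augmenting G (m omega) q, uniq (verts q),
  (size q <= N)%N & has_color c omega q].

Definition flippable omega q := candidate omega q /\
  forall q' x, candidate omega q' -> x \in verts q -> x \in verts q' -> q = q'.

Definition step omega := flip (m omega) (flippable omega).

Lemma candidate_gmap g omega q :
  candidate omega q -> candidate (act_vertex g omega) (gmap g q).
Proof.
move=> [aq uq sq cq]; split.
- by apply: augmenting_gmap aq => x; exact: fm_equiv.
- by rewrite verts_gmap map_inj_uniq //; exact: can_inj (@aut_funK _ _ g).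
- by rewrite size_map.
- rewrite /has_color -cq /gmap -map_comp; apply: eq_map => p /=.
  by rewrite /act_vertex /= !aut_funK.
Qed.

Lemma candidate_gmapV g omega q : candidate (act_vertex g omega) q ->
  candidate omega (gmap (aut_inv g) q).
Proof. by move=> /(candidate_gmap (graph_autV g)); rewrite act_vertexK. Qed.

Lemma flippable_gmap g omega q :
  flippable omega q -> flippable (act_vertex g omega) (gmap g q).
Proof.
move=> [cq iq]; split; first exact: candidate_gmap.
move=> q' x cq'; rewrite verts_gmap => /mapP[y yq ->] gyq'.
have qE : q = gmap (aut_inv g) q'.
  apply: (iq _ y (candidate_gmapV cq')) => //.
  by rewrite verts_gmap -(aut_funK g y) map_f.
by rewrite qE (gmapK (aut_invK g)).
Qed.

Lemma flippable_gmapV g omega q : flippable (act_vertex g omega) q ->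
  flippable omega (gmap (aut_inv g) q).
Proof. by move=> /(flippable_gmap (graph_autV g)); rewrite act_vertexK. Qed.

Lemma flippable_aug omega q : flippable omega q ->
  augmenting G (m omega) q /\ uniq (verts q).
Proof. by move=> [[]]. Qed.

Lemma flippable_disj omega q q' x : flippable omega q -> flippable omega q' ->
  x \in verts q -> x \in verts q' -> q = q'.
Proof. by move=> [_ iq] [cq' _]; exact: iq. Qed.

(** Automorphisms carry the flippable paths of [omega] onto those of the transported labels, because
    [flippable] refers to the graph, the labels and [m] alone. *)
Lemma step_equiv g omega x : step (act_vertex g omega) (g x) = g (step omega x).
Proof.
have [[q Fq [xq xfx]]|[nx fx]] :=
  flipP (@flippable_aug omega) (@flippable_disj omega) x.
  apply: (flip_partner (@flippable_aug _) (@flippable_disj _)).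
  case: xfx => r Fr xr; exists (gmap g r); first exact: flippable_gmap.
  by case/orP: xr => /(map_f (fun p => (g p.1, g p.2))) /= xr;
    rewrite /gmap xr ?orbT.
rewrite /step fx -(fm_equiv fm); apply: flip_id => q Fq; apply/negP => gxq.
have := nx _ (flippable_gmapV Fq).
by rewrite verts_gmap -{1}(aut_funK g x) map_f.
Qed.

Lemma step_matching omega : matching G (step omega).
Proof.
exact: (flip_matching G_sym (fm_matching fm omega) (@flippable_aug omega)
  (@flippable_disj omega)).
Qed.

Lemma countable_paths : countable [set: seq (Gamma * Gamma)].
Proof. by apply: countable_seq; exact: countable_prod. Qed.

Lemma mpred_links b q : mpred (fun omega => links G (m omega) b q).
Proof.
elim: q b => [b|p q IH b] /=; first exact: (fm_measurable fm).
apply: (@eq_mpred _ _ (fun omega => m omega b = p.1 /\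
  (G p.1 p.2 /\ links G (m omega) p.2 q))).
  by move=> omega; split=> [[? [? ?]]|[? ? ?]].
apply: mpred_and; first exact: (fm_measurable fm).
by apply: mpred_and => //; exact: mpred_cst.
Qed.

Lemma mpred_augmenting q : mpred (fun omega => augmenting G (m omega) q).
Proof.
case: q => [|p q] /=; first exact: mpred_cst.
apply: (@eq_mpred _ _ (fun omega => m omega p.1 = p.1 /\
  (G p.1 p.2 /\ links G (m omega) p.2 q))).
  by move=> omega; split=> [[? [? ?]]|[? ? ?]].
apply: mpred_and; first exact: (fm_measurable fm).
by apply: mpred_and; [exact: mpred_cst|exact: mpred_links].
Qed.

Lemma mpred_has_color q : mpred (fun omega => has_color c omega q).
Proof.
rewrite /has_color; case: c => n l /=; elim: q l => [l|p q IH [|[i j] l]] /=.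
- exact: mpred_cst.
- exact: (@eq_mpred _ _ (fun=> False)) (mpred_cst _ _).
- apply: (@eq_mpred _ _ (fun omega => (cell n (omega p.1) = i /\
    cell n (omega p.2) = j) /\
    [seq (cell n (omega p.1), cell n (omega p.2)) | p <- q] = l)).
    by move=> omega; split=> [[[-> ->] ->]|[-> -> ->]].
  apply: mpred_and; last exact: IH.
  by apply: mpred_and; exact: mpred_cell.
Qed.

Lemma mpred_candidate q : mpred (fun omega => candidate omega q).
Proof.
apply: (@eq_mpred _ _ (fun omega => augmenting G (m omega) q /\
  ((uniq (verts q) /\ (size q <= N)%N) /\ has_color c omega q))).
  by move=> omega; split=> [[? [[? ?] ?]]|[? ? ? ?]].
apply: mpred_and; first exact: mpred_augmenting.
by apply: mpred_and; [exact: mpred_cst|exact: mpred_has_color].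
Qed.

Lemma mpred_flippable q : mpred (fun omega => flippable omega q).
Proof.
apply: mpred_and; first exact: mpred_candidate.
apply: mpred_all => [|q']; first exact: countable_paths.
apply: mpred_all => // x; apply: mpred_imply; first exact: mpred_candidate.
exact: mpred_cst.
Qed.

Lemma mpred_step x y : mpred (fun omega => step omega x = y).
Proof.
apply: (@eq_mpred _ _ (fun omega =>
    (exists2 q, flippable omega q & ((x, y) \in q) || ((y, x) \in q)) \/
    ((forall q, flippable omega q -> x \notin verts q) /\ m omega x = y))).
  move=> omega; split=> [[xy|[nx <-]]|].
  - exact: (flip_partner (@flippable_aug _) (@flippable_disj _)).
  - exact: flip_id.
  - have [[q Fq [xq xfx]] <-|[nx fx] <-] :=
      flipP (@flippable_aug omega) (@flippable_disj omega) x; first by left.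
    by right; split.
apply: mpred_or.
  apply: mpred_ex2 => [|q|q]; [exact: countable_paths|exact: mpred_flippable|].
  exact: mpred_cst.
apply: mpred_and; last exact: (fm_measurable fm).
apply: mpred_all => [|q]; first exact: countable_paths.
by apply: mpred_imply; [exact: mpred_flippable|exact: mpred_cst].
Qed.

Lemma fm_step : factor_matching S step.
Proof. by split; [exact: step_matching|exact: step_equiv|exact: mpred_step]. Qed.

Section change.
Variable mu : probability Omega R.
Hypothesis mu_product : is_lebesgue_product mu.

(** A transport rule: with [pi] a projection, the vertex [x] in place [i] of a flipped path sends
    mass to the starting vertex [y] of that path. *)
Definition position (pi : Gamma * Gamma -> Gamma) i omega x y :=
  exists2 q, flippable omega q &
  [/\ (i < size q)%N, x = pi (nth (1%g, 1%g) q i) & y = (nth (1%g, 1%g) q 0).1].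

Lemma position_tau (pi : Gamma * Gamma -> Gamma) i s omega x y :
  (forall h p, pi (h p.1, h p.2) = h (pi p)) ->
  position pi i (tau s omega) x y <-> position pi i omega (x * s)%g (y * s)%g.
Proof.
move=> pih.
have shift s' omega' x' y' : position pi i omega' x' y' ->
    position pi i (tau s' omega') (x' * s'^-1)%g (y' * s'^-1)%g.
  move=> [q Fq [iq -> ->]]; exists (gmap (right_aut S s') q).
    exact: (flippable_gmap (right_aut S s')).
  split; first by rewrite size_map.
    by rewrite (nth_map (1%g, 1%g)) // pih.
  by rewrite (nth_map (1%g, 1%g)) //; exact: leq_ltn_trans iq.
split; last by move=> /(shift s); rewrite !mulgK.
move=> /(shift s^-1%g); rewrite invgK.
rewrite (_ : tau s^-1%g (tau s omega) = omega) //.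
by apply/funext => z; rewrite /tau mulgVK.
Qed.

Lemma mpred_position (pi : Gamma * Gamma -> Gamma) i x y :
  mpred (fun omega => position pi i omega x y).
Proof.
apply: mpred_ex2 => [|q|q]; [exact: countable_paths|exact: mpred_flippable|].
exact: mpred_cst.
Qed.

Let u := Pr mu [set omega | m omega 1%g = 1%g].
Let u' := Pr mu [set omega | step omega 1%g = 1%g].

(** A starting vertex lies on only one flipped path, so it receives from at most one sender. It was
    unmatched and becomes matched; as a flip never unmatches a vertex, this has probability at most
    [u - u']. *)
Lemma position_bound (pi : Gamma * Gamma -> Gamma) i :
  (forall h p, pi (h p.1, h p.2) = h (pi p)) ->
  Pr mu [set omega | exists y, position pi i omega 1%g y] <= u - u'.
Proof.
move=> pih; have mP := mpred_position pi i.
apply: le_trans (mass_transport mu_product Gamma_countable mP _ _) _.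
- by move=> s omega x y; exact: position_tau.
- move=> omega x x' y [q Fq [iq -> yq]] [q' Fq' [iq' -> yq']].
  suff -> : q = q' by [].
  have head r : (i < size r)%N -> (nth (1%g, 1%g) r 0).1 \in verts r.
    case: r => // p r _; by rewrite mem_verts_cons eqxx.
  apply: (flippable_disj Fq Fq' (x := y)); first by rewrite yq head.
  by rewrite yq' head.
have mm := fm_measurable fm 1%g 1%g; have ms := mpred_step 1%g 1%g.
have mE : measurable [set omega | exists x, position pi i omega x 1%g] by exact: mpred_ex.
rewrite /u /u' -(Ex_indic mu mm) -(Ex_indic mu ms) -(Ex_indic mu mE).
rewrite -ExB; [|exact: bm_indic|exact: bm_indic].
apply: le_Ex; [exact: bm_indic|by apply: bmB; exact: bm_indic|].
move=> omega; have fix_step : step omega 1%g = 1%g -> m omega 1%g = 1%g.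
  exact: (flip_fix (@flippable_aug omega) (@flippable_disj omega)).
have [[x [q Fq [iq _ yq]]]|nE] := pselect (exists x, position pi i omega x 1%g).
  case: q Fq iq yq => // p q Fq _ /= p1.
  have [] := flip_head (@flippable_aug omega) (@flippable_disj omega) Fq.
  rewrite -p1 => m1 s1.
  rewrite [X in _ <= X - _]indicE mem_set // [X in _ <= _ - X]indicE memNset //.
  by rewrite subr0 indicE ler_nat leq_b1.
rewrite [leLHS]indicE memNset // subr_ge0 !indicE ler_nat.
have [/fix_step m1|s1] := pselect (step omega 1%g = 1%g).
  by rewrite [X in (_ <= X)%N](_ : _ = 1%N) ?leq_b1 // mem_set.
by rewrite memNset.
Qed.

(** A vertex whose partner changes lies on a flipped path, in one of [N] places and as first or
    second end of a pair: [2 * N] transports in all. *)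
Lemma step_change :
  Pr mu [set omega | step omega 1%g <> m omega 1%g] <= (2 * N)%:R * (u - u').
Proof.
pose E pi i := [set omega | exists y, position pi i omega 1%g y].
have mE pi i : measurable (E pi i).
  by apply: mpred_ex => // y; exact: mpred_position.
have mD : measurable [set omega | step omega 1%g <> m omega 1%g].
  apply: mpred_not; apply: (@eq_mpred _ _ (fun omega =>
    exists2 y, step omega 1%g = y & m omega 1%g = y)).
    by move=> omega; split=> [[y -> ->]|<-]; [|exists (step omega 1%g)].
  by apply: mpred_ex2 => // y; [exact: mpred_step|exact: (fm_measurable fm)].
have -> : (2 * N)%:R * (u - u') = \sum_(i < N) ((u - u') + (u - u')).
  by rewrite sumr_const card_ord -[RHS]mulr_natl natrM; ring.
apply: (@le_trans _ _ (\sum_(i < N) (Pr mu (E fst i) + Pr mu (E snd i)))); last first.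
  by apply: ler_sum => i _; apply: lerD; exact: position_bound.
have bE pi i := bm_indic R (mE pi i).
under eq_bigr do rewrite -(Ex_indic mu (mE fst _)) -(Ex_indic mu (mE snd _)) -ExD //.
rewrite -(Ex_indic mu mD) -Ex_sum; last by move=> i; exact: bmD.
apply: le_Ex; [exact: bm_indic|by apply: bm_sum => i; exact: bmD|].
move=> omega; have ge0 pi i : 0 <= \1_(E pi i) omega :> R by rewrite indicE ler0n.
have [[q Fq [xq _]]|[nx fx]] :=
    flipP (@flippable_aug omega) (@flippable_disj omega) 1%g; last first.
  by rewrite indicE memNset ?sumr_ge0 // => i _; rewrite addr_ge0.
rewrite [leLHS]indicE; apply: (@le_trans _ _ 1).
  by rewrite -[leRHS]/(1%:R) ler_nat leq_b1.
have sq : (size q <= N)%N by case: Fq => -[].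
have [i iq Ei] : exists2 i, (i < size q)%N & E fst i omega \/ E snd i omega.
  move: xq; rewrite /verts mem_cat => /orP[] /mapP[p pq pE];
    exists (index p q); rewrite ?index_mem //; [left|right];
    exists (nth (1%g, 1%g) q 0).1, q => //; split; rewrite ?index_mem //;
    by rewrite nth_index.
have iN := leq_trans iq sq.
rewrite (bigD1 (Ordinal iN)) //=; apply: ler_wpDr.
  by apply: sumr_ge0 => j _; rewrite addr_ge0.
case: Ei => Ei.
  by rewrite [X in _ <= X + _]indicE mem_set // lerDl.
by rewrite [X in _ <= _ + X]indicE mem_set // lerDr.
Qed.

End change.

End flip_step.

(** * Limits of factor matchings *)

Lemma eventually_in_seq (T : eqType) (l : seq T) (P : T -> nat -> Prop) :
  (forall x, x \in l -> exists n0, forall n, (n0 <= n)%N -> P x n) ->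
  exists n0, forall n, (n0 <= n)%N -> forall x, x \in l -> P x n.
Proof.
elim: l => [_|x l IH evl]; first by exists 0%N.
have [n1 h1] := evl x (mem_head _ _).
have [|n2 h2] := IH; first by move=> y yl; apply: evl; rewrite inE yl orbT.
exists (maxn n1 n2) => n; rewrite geq_max => /andP[n1n n2n] y.
by rewrite inE => /orP[/eqP ->|yl]; [exact: h1|exact: h2].
Qed.

Lemma pair_map_inj (T : choiceType) (U : eqType) (f : T -> U) (Y : seq T)
    (q q' : seq (T * T)) : {in Y &, injective f} ->
  {subset verts q <= Y} -> {subset verts q' <= Y} ->
  [seq (f p.1, f p.2) | p <- q] = [seq (f p.1, f p.2) | p <- q'] -> q = q'.
Proof.
move=> f_inj; elim: q q' => [|p q IH] [|p' q'] //= qY q'Y [e1 e2 e].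
have -> : p = p'.
  have [p1Y p2Y] : p.1 \in Y /\ p.2 \in Y.
    by split; apply: qY; rewrite mem_verts_cons eqxx ?orbT.
  have [p'1Y p'2Y] : p'.1 \in Y /\ p'.2 \in Y.
    by split; apply: q'Y; rewrite mem_verts_cons eqxx ?orbT.
  by rewrite [p]surjective_pairing [p']surjective_pairing (f_inj _ _ p1Y p'1Y e1)
    (f_inj _ _ p2Y p'2Y e2).
congr (_ :: _); apply: IH => // y yq; [apply: qY|apply: q'Y];
  by rewrite mem_verts_cons yq !orbT.
Qed.

Lemma inj_unbounded (f : nat -> nat) T : injective f -> exists n, (T <= f n)%N.
Proof.
move=> f_inj; apply: contrapT => nex.
have fT n : (f n < T)%N by rewrite ltnNge; apply/negP => h; apply: nex; exists n.
pose h (i : 'I_T.+1) : 'I_T := Ordinal (fT i).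
have h_inj : injective h by move=> i j [] /f_inj ij; exact: val_inj.
by have := leq_card h h_inj; rewrite !card_ord ltnn.
Qed.

(** The decoded pair carries a dummy number, so that each colour recurs infinitely often. Recurrence
    is needed since a path may become augmenting only after other flips. *)
Definition color_at (t : nat) : nat * seq (nat * nat) :=
  let o : option ((nat * seq (nat * nat)) * nat) := choice.unpickle t in
  if o is Some p then p.1 else (0%N, [::]).

Lemma color_at_often c T : exists2 t, (T <= t)%N & color_at t = c.
Proof.
have f_inj : injective (fun n : nat => choice.pickle (c, n)).
  by move=> n n' /(pcan_inj choice.pickleK) [].
have [n Tn] := inj_unbounded T f_inj.
by exists (choice.pickle (c, n)) => //; rewrite /color_at choice.pickleK.
Qed.

Section limits.
Variables (R : realType) (Gamma : groupType) (S : {fset Gamma}).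
Local Notation UI := (unit_interval R).
Local Notation Omega := (product_space Gamma UI).
Local Notation G := (cayley S).
Hypothesis Gamma_countable : countable [set: Gamma].
Hypothesis G_sym : forall x y, G x y -> G y x.
Variable mu : probability Omega R.
Hypothesis mu_product : is_lebesgue_product mu.

Section limit.
Variable ms : nat -> Omega -> Gamma -> Gamma.
Hypothesis fms : forall t, factor_matching S (ms t).

Definition eventual omega x y := exists T, forall t, (T <= t)%N -> ms t omega x = y.

(** A vertex whose partner does not stabilize counts as unmatched, which keeps the limit an
    equivariant matching for every [omega]. *)
Definition lim_matching omega x := xget x [set y | eventual omega x y].

Lemma eventual_fun omega x y y' : eventual omega x y -> eventual omega x y' -> y = y'.
Proof.
move=> [T h] [T' h']; rewrite -(h (maxn T T')) ?leq_maxl //.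
by rewrite (h' (maxn T T')) ?leq_maxr.
Qed.

Lemma lim_eventual omega x y : eventual omega x y -> lim_matching omega x = y.
Proof.
move=> exy; apply: (eventual_fun _ exy).
by apply: (@xgetPex _ x [set y | eventual omega x y]); exists y.
Qed.

Lemma lim_matchingP omega x : eventual omega x (lim_matching omega x) \/
  ((forall y, ~ eventual omega x y) /\ lim_matching omega x = x).
Proof.
have [[y exy]|no] := pselect (exists y, eventual omega x y).
  by left; rewrite (lim_eventual exy).
have ny y : ~ eventual omega x y by move=> exy; apply: no; exists y.
by right; split=> //; exact: xgetPN.
Qed.

Lemma eventual_sym omega x y : eventual omega x y -> eventual omega y x.
Proof.
move=> [T h]; exists T => t Tt; rewrite -(h t Tt).
exact: (fm_matching (fms t) omega).1.
Qed.

Lemma eventual_act (g : graph_aut G) omega x y : eventual omega x y ->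
  eventual (act_vertex g omega) (g x) (g y).
Proof. by move=> [T h]; exists T => t Tt; rewrite (fm_equiv (fms t)) h. Qed.

Lemma mpred_eventual x y : mpred (fun omega => eventual omega x y).
Proof.
apply: mpred_ex => [|T]; first exact: countableP.
apply: mpred_all => [|t]; first exact: countableP.
by apply: mpred_imply; [exact: mpred_cst|exact: (fm_measurable (fms t))].
Qed.

Lemma fm_lim : factor_matching S lim_matching.
Proof.
split.
- move=> omega; split=> x; have [ex|[nx ->]] := lim_matchingP omega x.
  + exact/lim_eventual/eventual_sym.
  + by have [ex|[_ ->]] := lim_matchingP omega x => //; case: (nx _ ex).
  + case: ex => T h; rewrite -(h T (leqnn T)) => ne.
    exact: (fm_matching (fms T) omega).2.
  + by [].
- move=> g omega x; have [ex|[nx ->]] := lim_matchingP omega x.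
    exact/lim_eventual/eventual_act.
  have [ex|[_ -> //]] := lim_matchingP (act_vertex g omega) (g x).
  have := eventual_act (graph_autV g) ex.
  by rewrite act_vertexK /= aut_funK => /nx.
- move=> x y; apply: (@eq_mpred _ _ (fun omega => eventual omega x y \/
    ((forall z, ~ eventual omega x z) /\ x = y))).
    move=> omega; split=> [[|[nx <-]]|<-]; first exact: lim_eventual.
      by have [ex|[_ ->]] := lim_matchingP omega x => //; case: (nx _ ex).
    by have [ex|[nx ->]] := lim_matchingP omega x; [left|right].
  apply: mpred_or; first exact: mpred_eventual.
  apply: mpred_and; last exact: mpred_cst.
  by apply: mpred_all => // z; apply: mpred_not; exact: mpred_eventual.
Qed.

Definition changes x t := [set omega | ms t.+1 omega x <> ms t omega x].

Lemma measurable_changes x t : measurable (changes x t).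
Proof.
apply: mpred_not; apply: (@eq_mpred _ _ (fun omega =>
    exists2 y, ms t.+1 omega x = y & ms t omega x = y)).
  by move=> omega; split=> [[y -> ->]|<-]; [|exists (ms t.+1 omega x)].
by apply: mpred_ex2 => // y; exact: (fm_measurable (fms _)).
Qed.

Lemma mu_changes x t : mu (changes x t) = mu (changes 1%g t).
Proof.
rewrite -(mu_tau mu_product x (measurable_changes 1%g t)); congr (mu _).
apply/seteqP; split=> omega; rewrite /changes /= !(fm_tau (fms _)) mul1g => h.
  by move=> /mulIg.
by move=> e; apply: h; rewrite e.
Qed.

Variable B : R.
Hypothesis changes_bound : forall n, \sum_(t < n) Pr mu (changes 1%g t) <= B.

Lemma changes_series : (\sum_(t <oo) mu (changes 1%g t) <= B%:E)%E.
Proof.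
apply: lime_le; first by apply: is_cvg_nneseries => n _ _; exact: measure_ge0.
apply: nearW => n /=.
rewrite (eq_bigr (fun t => (Pr mu (changes 1%g t))%:E)); last first.
  by move=> t _; rewrite EFin_Pr //; exact: measurable_changes.
by rewrite sumEFin lee_fin big_mkord; exact: changes_bound.
Qed.

Lemma lim_change :
  Pr mu [set omega | lim_matching omega 1%g <> ms 0 omega 1%g] <= B.
Proof.
have mL : measurable [set omega | lim_matching omega 1%g <> ms 0 omega 1%g].
  apply: mpred_not; apply: (@eq_mpred _ _ (fun omega =>
    exists2 y, lim_matching omega 1%g = y & ms 0 omega 1%g = y)).
    by move=> omega; split=> [[y -> ->]|<-]; [|exists (lim_matching omega 1%g)].
  apply: mpred_ex2 => // y; [exact: (fm_measurable fm_lim)|exact: (fm_measurable (fms _))].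
rewrite -lee_fin EFin_Pr //; apply: le_trans changes_series.
apply: measure_sigma_subadditive => //; first by move=> n; exact: measurable_changes.
move=> omega /= ne; apply: contrapT => no; apply: ne; apply: lim_eventual.
exists 0%N => t _; elim: t => // t IH.
by rewrite -IH; apply: contrapT => ne; apply: no; exists t.
Qed.

Lemma ae_eventual : \forall omega \ae mu, forall x,
  eventual omega x (lim_matching omega x).
Proof.
apply: ae_all_countable => // x.
exists (lim_sup_set (changes x)); split.
- apply: bigcap_measurable; first by exists 0%N.
  by move=> n _; apply: bigcup_measurable => t _; exact: measurable_changes.
- apply: lim_sup_set_cvg0; first by move=> t; exact: measurable_changes.
  rewrite (eq_eseriesr (fun t _ => mu_changes x t)).
  exact: le_lt_trans changes_series (ltry _).
- move=> omega /= nev; apply: contrapT => /existsNP[T /not_implyP[_ nT]].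
  have stable t : (T <= t)%N -> ms t omega x = ms T omega x.
    elim: t => [|t IH]; first by rewrite leqn0 => /eqP ->.
    rewrite leq_eqVlt => /orP[/eqP -> //|]; rewrite ltnS => Tt.
    by rewrite -(IH Tt); apply: contrapT => ne; apply: nT; exists t.
  apply: nev; have ev : eventual omega x (ms T omega x) by exists T.
  by rewrite (lim_eventual ev).
Qed.

End limit.

Section stage.
Variables (m : Omega -> Gamma -> Gamma) (N : nat).
Hypothesis fm : factor_matching S m.

Fixpoint flips t : Omega -> Gamma -> Gamma :=
  if t is t'.+1 then step S (flips t') N (color_at t') else m.

Definition stage := lim_matching flips.

Lemma fm_flips t : factor_matching S (flips t).
Proof. by elim: t => //= t IH; exact: fm_step. Qed.

Lemma fm_stage : factor_matching S stage.
Proof. exact: fm_lim fm_flips. Qed.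

(** Each flip costs [2 * N] times the drop in the probability of being unmatched, and the drops
    telescope. The bound does not depend on [n], so infinitely many flips converge within one
    stage. *)
Lemma flips_bound n : \sum_(t < n) Pr mu (changes flips 1%g t) <=
  (2 * N)%:R * Pr mu [set omega | m omega 1%g = 1%g].
Proof.
pose u t := Pr mu [set omega | flips t omega 1%g = 1%g].
suff h : \sum_(t < n) Pr mu (changes flips 1%g t) <= (2 * N)%:R * (u 0%N - u n).
  by apply: (le_trans h); rewrite ler_wpM2l // lerBlDr lerDl; exact: Pr_ge0.
elim: n => [|n IH]; first by rewrite big_ord0 subrr mulr0.
rewrite big_ord_recr /=.
have := step_change Gamma_countable N (color_at n) (fm_flips n) mu_product.
rewrite -/(u n) -[X in _ * (_ - X)]/(u n.+1) => h.
apply: (le_trans (lerD IH h)); rewrite -mulrDr ler_wpM2l //; lra.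
Qed.

Lemma stage_change :
  Pr mu [set omega | stage omega 1%g <> m omega 1%g] <=
  (2 * N)%:R * Pr mu [set omega | m omega 1%g = 1%g].
Proof. exact: (lim_change fm_flips flips_bound). Qed.

Fixpoint ball n x : seq Gamma :=
  if n is n'.+1 then flatten [seq ball n' z | z <- x :: [seq (s * x)%g | s <- S]]
  else [:: x].

Lemma near_ball n x y : near G n x y -> y \in ball n x.
Proof.
elim: n x => [x /= ->|n IH x [z xz /IH yz]]; first exact: mem_head.
apply/flattenP; exists (ball n z) => //; apply: map_f; rewrite inE.
case: xz => [->|[s sS ->]]; first by rewrite eqxx.
by rewrite (map_f (fun s => (s * x)%g) sS) orbT.
Qed.

(** A surviving short path [q] would be augmenting at all late times. At a late time whose colour is
    that of [q], for cells fine enough to isolate [q], it would be flippable and its first vertex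
    would become matched, although the matching no longer changes there. *)
Lemma ae_stage : \forall omega \ae mu, forall q,
  augmenting G (stage omega) q -> uniq (verts q) -> (N < size q)%N.
Proof.
have ae1 := ae_eventual fm_flips flips_bound.
have ae2 := ae_labels_distinct mu_product Gamma_countable.
suff : \forall omega \ae mu, (forall x, eventual flips omega x (stage omega x)) /\
    (forall x y : Gamma, x <> y -> omega x <> omega y).
  apply: ae_imply => omega [ev lab] q aq uq; rewrite ltnNge; apply/negP => sq.
  (* A competitor has at most [N] pairs, so it stays within [r] of any vertex shared with [q]; [Y]
     contains all such vertices. *)
  pose r := (2 * N + 2 * N)%N.
  pose Y := flatten [seq ball r x | x <- verts q].
  have [|n sep] := @eventually_in_seq _ [seq (y, z) | y <- Y, z <- Y]
      (fun p n => p.1 <> p.2 -> cell n (omega p.1) <> cell n (omega p.2)).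
    move=> p _; have [pp|pp] := pselect (p.1 = p.2); first by exists 0%N.
    by have [n0 h] := cell_separates (lab _ _ pp); exists n0 => n /h.
  have {}sep := sep n (leqnn n).
  have cell_inj y z : y \in Y -> z \in Y ->
      cell n (omega y) = cell n (omega z) -> y = z.
    move=> yY zY e; apply: contrapT => yz.
    by apply: (sep (y, z) _ yz e); apply: allpairs_f.
  (* After time [T] the matching is final on the finitely many vertices of [q]. *)
  have [|T agree] := @eventually_in_seq _ (verts q)
      (fun x t => stage omega x = flips t omega x).
    by move=> x _; have [T h] := ev x; exists T => t /h.
  pose c := (n, [seq (cell n (omega p.1), cell n (omega p.2)) | p <- q]).
  have [t Tt ct] := color_at_often c T.
  have vY q' x : augmenting G (flips t omega) q' -> (size q' <= N)%N ->
      x \in verts q -> x \in verts q' -> {subset verts q' <= Y}.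
    move=> aq' sq' xq xq' y yq'; apply/flattenP; exists (ball r x); first exact: map_f.
    apply: near_ball.
    have := augmenting_near G_sym (fm_matching (fm_flips t) omega).2 aq' xq' yq'.
    have -> : r = (2 * size q' + 2 * size q' + (r - (2 * size q' + 2 * size q')))%N.
      by rewrite /r; lia.
    by move=> h; apply: near_trans h _; exact: near_refl.
  have aqt : augmenting G (flips t omega) q.
    by apply: augmenting_ext aq => x xq; exact: agree.
  have cq : candidate S (flips t) N c omega q by [].
  have fq : flippable S (flips t) N c omega q.
    split=> // q' x [aq' _ sq' cq'] xq xq'.
    have qY := vY q x aqt sq xq xq.
    have q'Y := vY q' x aq' sq' xq xq'.
    apply: (pair_map_inj (f := fun x => cell n (omega x)) _ qY q'Y (esym cq')).
    exact: cell_inj.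
  have qE : exists p q', q = p :: q' by case: (q) aq => // p q' _; exists p, q'.
  case: qE => p [q' qE].
  have fq' : flippable S (flips t) N (color_at t) omega (p :: q').
    by rewrite -qE ct.
  have [] := flip_head (@flippable_aug _ _ S (flips t) N (color_at t) omega)
    (@flippable_disj _ _ S (flips t) N (color_at t) omega) fq'.
  move=> _; apply; apply: (etrans (esym (agree t.+1 (leqW Tt) p.1 _))).
    by rewrite qE mem_verts_cons eqxx.
  by move: aq; rewrite qE => -[sp _ _].
case: ae1 => A1 [mA1 A10 sA1]; case: ae2 => A2 [mA2 A20 sA2].
apply: negligibleS (negligibleU _ _); last 2 first.
- by exists A1; split; [exact: mA1|exact: A10|exact: sA1].
- by exists A2; split; [exact: mA2|exact: A20|exact: sA2].
by move=> omega /= /not_andP[]; [left|right].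
Qed.

End stage.

End limits.

(** * The perfect matching *)

(** Multiplied by [(1 - r)^2], the sum has the closed form [1 - (n + 1) r^n + n r^(n + 1)], which is
    at most 1. *)
Lemma geometric_bound (R : realType) (r : R) n : 0 <= r -> r < 1 ->
  \sum_(t < n) t.+1%:R * r ^+ t <= ((1 - r) ^+ 2)^-1.
Proof.
move=> r0 r1; have pos : 0 < (1 - r) ^+ 2 by rewrite exprn_gt0 // subr_gt0.
rewrite -[leRHS]mul1r ler_pdivlMr //.
have -> : (\sum_(t < n) t.+1%:R * r ^+ t) * (1 - r) ^+ 2 =
    1 - n.+1%:R * r ^+ n + n%:R * r ^+ n.+1.
  elim: n => [|n IH]; first by rewrite big_ord0 mul0r mul0r expr0 mulr1 subrr addr0.
  rewrite big_ord_recr /= mulrDl IH !exprS -(natr1 n.+1) -(natr1 n).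
  by ring.
have : n%:R * r ^+ n.+1 <= n.+1%:R * r ^+ n.
  by rewrite ler_pM ?exprn_ge0 ?ler_nat // exprS ler_piMl ?exprn_ge0 // ltW.
lra.
Qed.

Section perfect_factor.
Variables (R : realType) (Gamma : groupType) (S : {fset Gamma}).
Local Notation UI := (unit_interval R).
Local Notation Omega := (product_space Gamma UI).
Local Notation G := (cayley S).
Hypothesis Gamma_countable : countable [set: Gamma].
Hypothesis G_sym : forall x y, G x y -> G y x.
Variable mu : probability Omega R.
Hypothesis mu_product : is_lebesgue_product mu.

Lemma Pr_fixed m x : factor_matching S m ->
  Pr mu [set omega | m omega x = x] = Pr mu [set omega | m omega 1%g = 1%g].
Proof.
move=> fm; rewrite -(Pr_tau mu_product x (fm_measurable fm 1%g 1%g)).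
congr (Pr mu _); apply/seteqP; split=> omega; rewrite /= (fm_tau fm) mul1g.
  by move=> ->; rewrite mulgV.
by move=> /(canRL (mulgVK x)); rewrite mul1g.
Qed.

Lemma fm_id : factor_matching S (fun (_ : Omega) x => x).
Proof.
by split=> [omega|//|x y]; [split|exact: mpred_cst].
Qed.

(** Stage [n] removes the paths with at most [2 * n + 1] listed edges, as the density bound with
    exponent [n] requires. *)
Fixpoint stages n : Omega -> Gamma -> Gamma :=
  if n is n'.+1 then stage S (stages n') (2 * n + 1) else stage S (fun _ x => x) 1.

Lemma fm_stages n : factor_matching S (stages n).
Proof.
by elim: n => [|n IH]; apply: (fm_stage Gamma_countable G_sym) => //; exact: fm_id.
Qed.

Lemma ae_stages n : \forall omega \ae mu, forall q,
  augmenting G (stages n omega) q -> uniq (verts q) -> (2 * n + 1 < size q)%N.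
Proof.
by case: n => [|n]; apply: ae_stage => //; (exact: fm_id || exact: fm_stages).
Qed.

Variable r : R.
Hypothesis r_ge0 : 0 <= r.
Hypothesis r_lt1 : r < 1.
Hypothesis density : forall m n, factor_matching S m ->
  (\forall omega \ae mu, forall q, augmenting G (m omega) q -> uniq (verts q) ->
    (2 * n + 1 < size q)%N) ->
  Pr mu [set omega | m omega 1%g = 1%g] <= r ^+ n.

Definition perfect := lim_matching stages.

Lemma fm_perfect : factor_matching S perfect.
Proof. exact: fm_lim fm_stages. Qed.

Lemma stages_changes n :
  \sum_(t < n) Pr mu (changes stages 1%g t) <= 6 * ((1 - r) ^+ 2)^-1.
Proof.
apply: (@le_trans _ _ (6 * \sum_(t < n) t.+1%:R * r ^+ t)); last first.
  by rewrite ler_wpM2l // geometric_bound.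
rewrite mulr_sumr; apply: ler_sum => t _.
apply: (le_trans (stage_change Gamma_countable G_sym mu_product _ (fm_stages t))).
rewrite mulrA; apply: ler_pM => //; first exact: Pr_ge0.
  (* Stage [t.+1] has [N = 2 * t + 3], and [2 * N = 4 * t + 6] is at most [6 * t.+1]; hence the
     constant 6. *)
  by rewrite -natrM ler_nat; lia.
exact: density (fm_stages t) (ae_stages t).
Qed.

(** A vertex unmatched in the limit is, where stages converge, unmatched from some stage [T] on. For
    given [x] and [T] this has probability at most [r ^ n] for every [n >= T], hence zero, and there
    are countably many pairs [(x, T)]. *)
Lemma ae_perfect : \forall omega \ae mu, forall x, perfect omega x <> x.
Proof.
have ev := ae_eventual Gamma_countable mu_product fm_stages stages_changes.
suff nofix : \forall omega \ae mu, forall p : Gamma * nat,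
    ~ forall t, (p.2 <= t)%N -> stages t omega p.1 = p.1.
  case: ev nofix => A1 [mA1 A10 sA1] [A2 [mA2 A20 sA2]].
  exists (A1 `|` A2); split; first exact: measurableU.
    by rewrite measureU0.
  move=> omega /= /existsNP[x /contrapT px].
  have [[T h]|nev] := pselect (eventual stages omega x (perfect omega x)).
    right; apply: sA2 => /= /(_ (x, T)); apply => t Tt /=.
    by rewrite h // px.
  by left; apply: sA1 => /= /(_ x).
apply: ae_all_countable => [|[x T]] /=.
  by apply: countable_prod => //; exact: countableP.
set A := [set omega | forall t, (T <= t)%N -> stages t omega x = x].
have mA : measurable A.
  apply: mpred_all => [|t]; first exact: countableP.
  by apply: mpred_imply; [exact: mpred_cst|exact: (fm_measurable (fm_stages t))].
exists A; split => //; last by move=> omega /= /contrapT.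
rewrite -EFin_Pr //; congr (_%:E); apply/eqP; rewrite eq_le Pr_ge0 andbT.
apply/ler_addgt0Pr => e e0; rewrite add0r.
have /cvgrPdist_le /(_ e e0) [n _ /(_ (maxn n T) (leq_maxl _ _)) /=] :=
  @cvg_expr R r (ltac:(by rewrite ger0_norm)).
rewrite sub0r normrN ger0_norm ?exprn_ge0 // => rn.
apply: le_trans rn; apply: le_trans (density (fm_stages _) (ae_stages _)).
rewrite -(Pr_fixed x (fm_stages _)); apply: Pr_le => //.
  exact: (fm_measurable (fm_stages _)).
by move=> omega; apply; exact: leq_maxr.
Qed.

Definition edge_factor (omega : Omega) : product_space (edge G) bool :=
  fun a => `[< exists x, perfect omega x <> x /\ val a = [set x; perfect omega x] >].

Lemma mpred_edge_factor a : mpred (fun omega => edge_factor omega a).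
Proof.
apply: (@eq_mpred _ _ (fun omega => exists x, exists2 y, perfect omega x = y &
    y <> x /\ val a = [set x; y])).
  move=> omega; split=> [[x [y <- h]]|/asboolP[x h]].
    by apply/asboolP; exists x.
  by exists x, (perfect omega x).
apply: mpred_ex => // x; apply: mpred_ex2 => // y; last exact: mpred_cst.
exact: (fm_measurable fm_perfect).
Qed.

Lemma is_factor_edge_factor : is_factor edge_factor.
Proof.
split.
  apply: (@measurability _ _ _ _ setT edge_factor
    (@coordinate_sets (edge G) _ bool)) => //.
  move=> _ [_ [a _ [B mB <-]] <-]; rewrite !setTI.
  apply: (@eq_mpred _ _ (fun omega => (edge_factor omega a /\ B true) \/
      (~ edge_factor omega a /\ B false))).
    move=> omega /=; case: (edge_factor omega a); split=> //.
    - by case=> -[].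
    - by move=> ?; left.
    - by case=> -[] // [].
    - by move=> ?; right.
  apply: mpred_or; apply: mpred_and; try exact: mpred_cst.
    exact: mpred_edge_factor.
  by apply: mpred_not; exact: mpred_edge_factor.
move=> g omega; apply/funext => a; apply: asbool_equiv_eq.
have perfectV x : perfect (act_vertex g omega) x = g (perfect omega (aut_inv g x)).
  by rewrite -(fm_equiv fm_perfect) aut_invK.
split=> -[x [px ax]].
  exists (aut_inv g x); split.
    by move=> e; apply: px; rewrite perfectV e aut_invK.
  by rewrite /= ax image_setU !image_set1 perfectV aut_funK.
exists (g x); split.
  by rewrite perfectV aut_funK => /(can_inj (@aut_funK _ _ g)).
have gK (A : set Gamma) : g @` (aut_inv g @` A) = A.
  apply/seteqP; split=> [_ [_ [y Ay <-] <-]|y Ay]; first by rewrite aut_invK.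
  by exists (aut_inv g y); rewrite ?aut_invK //; exists y.
rewrite perfectV aut_funK -(gK (val a)); move: ax => /= ->.
by rewrite image_setU !image_set1.
Qed.

Lemma perfect_edge_factor omega : (forall x, perfect omega x <> x) ->
  perfect_matching [set a | edge_factor omega a].
Proof.
move=> px x; have [pK pG] := fm_matching fm_perfect omega.
have ex : [set x; perfect omega x] \in edges G.
  by rewrite inE; exists x, (perfect omega x); split => //; exact/pG/px.
exists (exist _ [set x; perfect omega x] ex); split=> /=.
  by split; [apply/asboolP; exists x|left].
move=> a' [/asboolP[y [_ ay]] a'x]; apply: val_inj => /=; rewrite ay in a'x *.
by case: a'x => ->; rewrite ?pK // setUC.
Qed.

End perfect_factor.

Theorem theorem2p4 (R : realType) (Gamma : groupType) (S : {fset Gamma})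
    (S_sym : {in S, forall s, s^-1%g \in S})
    (S_gen : generates S)
    (G_simple : simple_graph (cayley S))
    (G_bipartite : bipartite (cayley S))
    (G_nonamenable : nonamenable R (cayley S))
    (mu : probability (product_space Gamma (unit_interval R)) R)
    (mu_product : is_lebesgue_product mu) :
  exists phi : product_space Gamma (unit_interval R) ->
               product_space (edge (cayley S)) bool,
    is_factor phi /\
    {ae mu, forall omega, perfect_matching [set a | phi omega a]}.
Proof.
have cG := generated_countable S_sym S_gen.
have [G_sym _] := G_simple; have [color bip] := G_bipartite.
have [kappa kappa0 expanding] := nonamenable_expanding S_sym G_nonamenable.
set d : R := #|` S|%:R.
(* A single vertex has at most [|S|] outgoing pairs. This makes [S] nonempty and [C] nonnegative. *)
have kd : kappa <= d.
  have := expanding [fset 1%g]%fset; rewrite cardfs1 mulr1 big_seq_fset1.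
  move=> /le_trans; apply; apply: (@le_trans _ _ (\sum_(s <- S) 1)).
    by apply: ler_sum => s _; rewrite -[leRHS]/(1%:R) ler_nat leq_b1.
  by rewrite big_const_seq count_predT iter_addr_0.
have d0 : 0 < d by exact: lt_le_trans kd.
have S0 : (0 < #|` S|)%N by rewrite -(ltr0n R).
pose C := d - kappa ^+ 2 / (8 * d).
have C0 : 0 <= C.
  rewrite subr_ge0 ler_pdivrMr ?mulr_gt0 //.
  have : kappa ^+ 2 <= d ^+ 2 by rewrite ler_sqr ?nnegrE ?(ltW kappa0) ?(ltW d0).
  have : 0 <= d ^+ 2 by exact: sqr_ge0.
  have -> : d * (8 * d) = 8 * d ^+ 2 by ring.
  lra.
have Cd : C < d.
  by rewrite /C ltrBlDr ltrDl divr_gt0 ?exprn_gt0 ?mulr_gt0.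
have gap h Y suppY h0 := @cheeger R Gamma S kappa kappa0 expanding h Y suppY h0 S0.
have S_neq0 : S != fset0 by rewrite -cardfs_gt0.
have /andP[r0 r1] := rate_itv C0 Cd.
have density m n (fm : factor_matching S m) :=
  unmatched_small cG fm mu_product G_sym bip C0 Cd gap S_neq0 (n := n).
exists (@edge_factor R Gamma S); split; first exact: is_factor_edge_factor.
have := ae_perfect cG G_sym mu_product r0 r1 density.
by apply: ae_imply => omega; exact: perfect_edge_factor.
Qed.
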